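(* Let $m\ge2$ and let $N$ be the Kunz nilsemigroup of a face of $\mathcal C_m$ with trivial Kunz subgroup. Then $N$ is a refinement of some staircase Kunz nilsemigroup $N'$ (of a face of $\mathcal C_m$ with trivial Kunz subgroup) with the same atom set as $N$. Moreover, if $N$ and $N'$ have $\beta$ and $\beta'$ outer Betti elements, respectively, and $\rho$ is a minimal presentation of $N$, then $|\rho|+\beta\le\beta'$. In particular, if $S$ and $S'$ are numerical semigroups containing $m$ whose Kunz nilsemigroups are $N$ and $N'$, respectively, then $\eta(S)\le\eta(S')$.
   Context: Kunz cone $\mathcal C_m\subseteq\mathbb R^{m-1}$ (coordinates indexed by nonzero residues of $\mathbb Z_m$, $x_0=0$): defined by $x_i+x_j\ge x_{i+j}$ for nonzero $i,j$ with $i+j\ne 0$. A face $F$ has trivial Kunz subgroup if no $x_i$ ($i\ne0$) vanishes identically on $F$; its Kunz nilsemigroup is then $\mathbb Z_m\cup\{\infty\}$ with nil element $\infty$ and $a\oplus b=a+b$ if $x_a+x_b=x_{a+b}$ on all of $F$, $\infty$ otherwise. Atoms are nonzero elements not a sum of two nonzero elements; with atoms $p_1,\dots,p_k$, $\mathsf Z_N(n)=\{z\in\mathbb Z^k_{\ge0}:z_1p_1\oplus\cdots\oplus z_kp_k=n\}$. $N$ is staircase if every non-nil element has exactly one factorization. $N$ is a refinement of $N'$ (same atoms) if $\mathsf Z_{N'}(i)\subseteq\mathsf Z_N(i)$ for each non-nil $i$. Outer Betti element: with $\mathrm{supp}(z)=\{i:z_i>0\}$, $\mathrm{supp}(B)=\bigcup_{z\in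 B}\mathrm{supp}(z)$, $B-e_i=\{z-e_i:z\in B,z_i>0\}$, it is a subset $B\subseteq\mathsf Z_N(\infty)$ such that (i) for each $i\in\mathrm{supp}(B)$, $B-e_i=\mathsf Z_N(q)$ for some non-nil $q$, and (ii) the graph on $B$ joining elements with intersecting supports is connected. Presentations: the factorization map $\varphi:\mathbb Z^k_{\ge0}\to N$, $z\mapsto z_1p_1\oplus\cdots\oplus z_kp_k$, induces the congruence $a\sim b\iff\varphi(a)=\varphi(b)$ on $\mathbb Z^k_{\ge0}$. A presentation of $N$ is a set of pairs obtained from a generating set of this congruence by discarding pairs $(a,b)$ with $\varphi(a)=\infty$; it is minimal if no proper subset is a presentation. Analogously, for a numerical semigroup $S$ (a cofinite submonoid of $\mathbb Z_{\ge0}$) with minimal generators $n_1,\dots,n_e$, $\eta(S)$ is the cardinality of any minimal generating set of the kernel congruence of $\mathbb Z^e_{\ge0}\to S$ (all minimal presentations have the same cardinality). The Kunz nilsemigroup of a numerical semigroup $S\ni m$: for $i\in\mathbb Z_m$ let $w_i$ be the least element of $S$ congruent to $i$ mod $m$ (the Apéry set); it is $\mathbb Z_m\cup\{\infty\}$ with $a\oplus b=a+b$ if $w_a+w_b=w_{a+b}$ and $\infty$ otherwise.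
   Formalization: The last claim η(S) ≤ η(S') is proved assuming that if m is a minimal generator of S then it is one of S'; without this it fails, e.g. m = 2, S = ⟨2,3⟩, S' = ⟨1⟩ have the same Kunz nilsemigroup but η(S) = 1 > 0 = η(S'). *)

(* Defs.v *)
From Stdlib Require Export Relation_Operators.
From HB Require Export structures.
From mathcomp Require Export all_boot all_order all_algebra finmap.
From mathcomp Require Export boolp classical_sets functions cardinality reals.

Set Implicit Arguments.
Unset Strict Implicit.
Unset Printing Implicit Defensive.

Import Order.TTheory GRing.Theory Num.Theory.

Local Open Scope classical_set_scope.
Local Open Scope ring_scope.

(* Only meaningful for finite sets: [fset_set A] is empty when [A] is infinite,
   so every use is accompanied by [finite_set A]. *)
Definition ncard (T : choiceType) (A : set T) : nat := (#|` fset_set A|)%fset.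

Definition inclusion_minimal (T : Type) (P : set (set T)) (A : set T) : Prop :=
  P A /\ forall B, P B -> B `<=` A -> B = A.

(* A point of R^(m-1) is a function on all of Z_m vanishing at 0; ['Z_m] is the
   ring of integers mod m only when [1 < m]. *)
Definition kunz_cone (R : realType) (m : nat) : set {ffun 'Z_m -> R} :=
  [set x : {ffun 'Z_m -> R} | x 0 = 0 /\
    forall i j : 'Z_m, i != 0 -> j != 0 -> i + j != 0 -> x (i + j) <= x i + x j].

(* Faces of a cone: the zero loci on it of the linear forms that are nonnegative
   on it (the cone itself is the face given by the zero form). *)
Definition kunz_face (R : realType) (m : nat) (F : set {ffun 'Z_m -> R}) : Prop :=
  exists c : {ffun 'Z_m -> R},
    (forall x, kunz_cone x -> 0 <= \sum_(i | i != 0) c i * x i) /\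
    F = [set x | kunz_cone x /\ \sum_(i | i != 0) c i * x i = 0].

Definition trivial_kunz_subgroup (R : realType) (m : nat)
    (F : set {ffun 'Z_m -> R}) : Prop :=
  forall i : 'Z_m, i != 0 -> ~ (forall x, F x -> x i = 0).

(* A binary operation on Z_m together with a nil element, [None]. *)
Definition nilop (m : nat) := option 'Z_m -> option 'Z_m -> option 'Z_m.

Definition truncated_add (m : nat) (P : 'Z_m -> 'Z_m -> Prop) : nilop m :=
  fun u v => if (u, v) is (Some a, Some b) then
    (if `[< P a b >] then Some (a + b) else None) else None.

Definition nilop_of_face (R : realType) (m : nat) (F : set {ffun 'Z_m -> R}) :
    nilop m :=
  truncated_add (fun a b => forall x, F x -> x a + x b = x (a + b)).

Definition kunz_nilsemigroup (R : realType) (m : nat) (N : nilop m) : Prop :=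
  exists F : set {ffun 'Z_m -> R},
    [/\ kunz_face F, trivial_kunz_subgroup F & N = nilop_of_face F].

Definition atoms (m : nat) (N : nilop m) : set (option 'Z_m) :=
  [set u | u <> Some 0 /\
    forall v w : option 'Z_m, v <> Some 0 -> w <> Some 0 -> N v w <> u].

Definition enumerates (T : eqType) (k : nat) (p : k.-tuple T) (A : set T) : Prop :=
  uniq p /\ [set` p] = A.

Notation expvec k := {ffun 'I_k -> nat}.

Definition factorization_map (m k : nat) (N : nilop m)
    (p : k.-tuple (option 'Z_m)) (z : expvec k) : option 'Z_m :=
  \big[N/Some 0]_(i < k) iter (z i) (N (tnth p i)) (Some 0).

Definition factorizations (m k : nat) (N : nilop m) (p : k.-tuple (option 'Z_m))
    (n : option 'Z_m) : set (expvec k) :=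
  [set z | factorization_map N p z = n].

Definition staircase (m k : nat) (N : nilop m) (p : k.-tuple (option 'Z_m)) : Prop :=
  forall i : 'Z_m, exists! z, factorizations N p (Some i) z.

Definition refinement (m k : nat) (N N' : nilop m) (p : k.-tuple (option 'Z_m)) : Prop :=
  atoms N = atoms N' /\
  forall i : 'Z_m, factorizations N' p (Some i) `<=` factorizations N p (Some i).

Definition supp (k : nat) (z : expvec k) : set 'I_k := [set i | (0 < z i)%N].

Definition suppB (k : nat) (B : set (expvec k)) : set 'I_k := \bigcup_(z in B) supp z.

Definition shift_down (k : nat) (B : set (expvec k)) (i : 'I_k) : set (expvec k) :=
  [set [ffun j => (z j - (j == i))%N] | z in [set z | B z /\ (0 < z i)%N]].

(* Connected graphs are nonempty. *)
Definition support_connected (k : nat) (B : set (expvec k)) : Prop :=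
  B !=set0 /\
  forall y z, B y -> B z ->
    clos_refl_trans (expvec k)
      (fun u v => [/\ B u, B v & supp u `&` supp v !=set0]) y z.

Definition outer_betti (m k : nat) (N : nilop m) (p : k.-tuple (option 'Z_m)) :
    set (set (expvec k)) :=
  [set B | [/\ B `<=` factorizations N p None,
    forall i, suppB B i ->
      exists q : 'Z_m, shift_down B i = factorizations N p (Some q)
    & support_connected B]].

Definition congruence (k : nat) (E : set (expvec k * expvec k)) : Prop :=
  [/\ forall a, E (a, a),
      forall a b, E (a, b) -> E (b, a),
      forall a b c, E (a, b) -> E (b, c) -> E (a, c)
    & forall a b c : expvec k, E (a, b) -> E (a + c, b + c)].

Definition kernel (k : nat) (T : Type) (f : expvec k -> T) : set (expvec k * expvec k) :=
  [set ab | f ab.1 = f ab.2].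

Definition generating_set (k : nat) (E sigma : set (expvec k * expvec k)) : Prop :=
  smallest (@congruence k) sigma = E.

Definition presentation (m k : nat) (N : nilop m) (p : k.-tuple (option 'Z_m))
    (rho : set (expvec k * expvec k)) : Prop :=
  exists sigma, generating_set (kernel (factorization_map N p)) sigma /\
    rho = [set ab | sigma ab /\ factorization_map N p ab.1 <> None].

Definition minimal_presentation (m k : nat) (N : nilop m) (p : k.-tuple (option 'Z_m)) :
    set (expvec k * expvec k) -> Prop :=
  inclusion_minimal (presentation N p).

Definition submonoid (M : set nat) : Prop :=
  M 0%N /\ forall a b, M a -> M b -> M (a + b)%N.

Definition numerical_semigroup (S : set nat) : Prop :=
  submonoid S /\ finite_set (~` S).

Definition minimal_generators (S : set nat) : set (set nat) :=
  inclusion_minimal (fun G => smallest submonoid G = S).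

Definition semigroup_factorization_map (e : nat) (g : e.-tuple nat) (z : expvec e) : nat :=
  (\sum_(i < e) z i * tnth g i)%N.

Definition semigroup_minimal_presentation (e : nat) (g : e.-tuple nat) :
    set (expvec e * expvec e) -> Prop :=
  inclusion_minimal (generating_set (kernel (semigroup_factorization_map g))).

Definition apery (S : set nat) (m : nat) (i : 'Z_m) : nat :=
  xget 0%N [set w | [/\ S w, w = i %[mod m]
    & forall s, S s -> s = i %[mod m] -> (w <= s)%N]].

Definition nilop_of_semigroup (S : set nat) (m : nat) : nilop m :=
  truncated_add (fun a b : 'Z_m =>
    (apery S a + apery S b)%N = apery S (a + b)).
Arguments nilop_of_semigroup : clear implicits.

(* Main.v *)
(* A nilsemigroup of a face with trivial Kunz subgroup is given by a point x of the
   cone with positive coordinates: a + b is non-nil exactly when x_a + x_b = x_(a+b),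
   and z factors a non-nil element exactly when its weight sum_j z_j x_(p_j) equals
   x at its residue sum_j z_j p_j (in general the weight is at least that value).

   Perturbing x generically singles out one factorization t(q) of every residue q;
   this is the staircase refinement N'. The outer Betti elements of N' are the
   singletons {b}, for b minimal among the vectors that are nil in N'. Replacing b
   by t(res b) lowers the weight for N', so:
   - the pairs (b, t(res b)), for those b that are non-nil in N, present N;
   - each outer Betti element of N contains one of the b that are nil in N, namely
     its vector of least weight, and distinct ones are disjoint.
   Modulo the pairs of factorizations with a common generator, which come for free
   by cancellation, presentations are the spanning edge sets of a graph, so Steinitz
   exchange bounds every minimal one by any other.

   For a semigroup S with nilsemigroup N, the analogous relations
   (b, t(res b) + c e_m), with c making the values agree, present S for all b; for
   S' they are also irredundant, because b shares no generator with any other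
   factorization of its value. If m is not a minimal generator, it is itself the
   value of one of the b, whose relation becomes trivial when e_m is replaced by b. *)
Require Import Defs.
From mathcomp Require Import ring zify.
Set Implicit Arguments.
Unset Strict Implicit.
Unset Printing Implicit Defensive.
Import Order.TTheory GRing.Theory Num.Theory.
Local Open Scope classical_set_scope.
Local Open Scope nat_scope.

(** * Finite sets and cardinality bounds *)

Section Cardinality.
Variable T : choiceType.
Implicit Types (A B : set T) (s : seq T).

Lemma ncard_seq A s : uniq s -> A = [set` s] -> ncard A = size s.
Proof.
move=> us ->; rewrite /ncard.
have -> : [set` s] = [set` [fset x in s]%fset].
  by apply/seteqP; split=> x /=; rewrite !inE.
by rewrite set_fsetK card_fseq undup_id.
Qed.

Lemma finite_set_uniq_seq A :
  finite_set A -> exists s, [/\ uniq s, A = [set` s] & ncard A = size s].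
Proof.
move=> /finite_seqP[s As]; exists (undup s).
have Au : A = [set` undup s].
  by rewrite As; apply/seteqP; split=> x /=; rewrite mem_undup.
by split; rewrite ?undup_uniq // (ncard_seq (undup_uniq s)).
Qed.

Lemma finite_set_bounded_size A n :
  (forall s, uniq s -> [set` s] `<=` A -> size s <= n) ->
  finite_set A /\ ncard A <= n.
Proof.
move=> An; have fA : finite_set A.
  apply: contrapT => /(@infinite_set_fset _ _ n.+1)[B BA].
  rewrite leqNgt => /negP; apply.
  by rewrite ltnS (An _ (fset_uniq B)).
split=> //; have [s [us As ->]] := finite_set_uniq_seq fA.
by apply: An => //; rewrite As.
Qed.

Lemma seq_leq_ncard A s : finite_set A -> uniq s -> [set` s] `<=` A ->
  size s <= ncard A.
Proof.
move=> /finite_set_uniq_seq[r [ur Ar ->]] us; rewrite Ar => sr.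
exact: uniq_leq_size.
Qed.

Lemma finite_set_min (R : realType) A (h : T -> R) : finite_set A -> A !=set0 ->
  exists2 x, A x & forall y, A y -> (h x <= h y)%R.
Proof.
move=> /finite_seqP[s ->]; elim: s => [[]//|a s IH] _.
have [[y sy]|s0] := pselect ([set` s] !=set0).
  have [x sx xmin] := IH (ex_intro _ _ sy).
  have [ax|/ltW xa] := leP (h a) (h x).
    exists a => [|z] /=; first by rewrite inE eqxx.
    by rewrite inE => /predU1P[->//|/xmin]; exact: le_trans.
  exists x => [|z] /=; first by rewrite inE sx orbT.
  by rewrite inE => /predU1P[->//|/xmin].
exists a => [|z] /=; first by rewrite inE eqxx.
by rewrite inE => /predU1P[->//|sz]; case: s0; exists z.
Qed.

End Cardinality.

(** A counterexample of least [h] would satisfy the induction hypothesis. *)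
Lemma finite_set_wf_ind (T : choiceType) (R : realType) (A : set T) (h : T -> R)
    (P : T -> Prop) : finite_set A ->
  (forall x, A x -> (forall y, A y -> (h y < h x)%R -> P y) -> P x) ->
  forall x, A x -> P x.
Proof.
move=> fA IH x Ax; apply: contrapT => nPx.
pose B := [set y | A y /\ ~ P y].
have fB : finite_set B by apply: sub_finite_set fA => y [].
have [y [Ay nPy] ymin] := finite_set_min h fB (ex_intro _ x (conj Ax nPx)).
apply/nPy/IH => // z Az zy; apply: contrapT => nPz.
by have := ymin z (conj Az nPz); rewrite leNgt zy.
Qed.

Lemma ncard_inj_leq (T U : choiceType) (A : set T) (B : set U) (h : T -> U) :
  finite_set B -> (forall x, A x -> B (h x)) ->
  (forall x y, A x -> A y -> h x = h y -> x = y) ->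
  finite_set A /\ ncard A <= ncard B.
Proof.
move=> fB hAB hinj; apply: finite_set_bounded_size => s us sA.
rewrite -(size_map h); apply: seq_leq_ncard => //.
  by rewrite map_inj_in_uniq // => x y sx sy; apply: hinj; exact: sA.
by move=> _ /= /mapP[x sx ->]; apply/hAB/sA.
Qed.

(** * Closures of graphs and presentations of congruences *)

Section EquivalenceClosure.
Variable V : eqType.
Implicit Types (G H : V -> V -> Prop) (s t : V * V) (l I tau : seq (V * V)).

Definition eqcl G : V -> V -> Prop := clos_refl_sym_trans V G.

Definition add_pair G t : V -> V -> Prop := fun x y => G x y \/ (x, y) = t.

Definition add_set G (A : set (V * V)) : V -> V -> Prop :=
  fun x y => G x y \/ A (x, y).

Lemma eqcl_sub G H x y :
  (forall u v, G u v -> eqcl H u v) -> eqcl G x y -> eqcl H x y.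
Proof.
move=> GH; elim=> [u v /GH //|u|u v _|u v w _ uv _ vw].
- exact: rst_refl.
- exact: rst_sym.
- exact: rst_trans vw.
Qed.

Lemma eqcl_mono G H x y :
  (forall u v, G u v -> H u v) -> eqcl G x y -> eqcl H x y.
Proof. by move=> GH; apply: eqcl_sub => u v /GH; exact: rst_step. Qed.

(** A simple path crosses the new edge [t] at most once, in one of its two directions. *)
Lemma eqcl_add_pair G t x y : eqcl (add_pair G t) x y ->
  [\/ eqcl G x y, eqcl G x t.1 /\ eqcl G t.2 y | eqcl G x t.2 /\ eqcl G t.1 y].
Proof.
have S := @rst_sym V G; have T := @rst_trans V G.
elim=> {x y} [x y [Gxy|<-]|x|x y _|x y z _ xy _ yz].
- by apply: Or31; exact: rst_step.
- by apply: Or32; split; exact: rst_refl.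
- by apply: Or31; exact: rst_refl.
- by case=> [h|[h h']|[h h']]; [apply: Or31|apply: Or33|apply: Or32];
    try split; exact: S.
- case: xy => [a|[a b]|[a b]]; case: yz => [c|[c d]|[c d]].
  + by apply: Or31; exact: T c.
  + by apply: Or32; split=> //; exact: T c.
  + by apply: Or33; split=> //; exact: T c.
  + by apply: Or32; split=> //; exact: T c.
  + by apply: Or32.
  + by apply: Or31; exact: T d.
  + by apply: Or33; split=> //; exact: T c.
  + by apply: Or31; exact: T d.
  + by apply: Or33.
Qed.

(** The path joining the ends of [s] has to cross [t]; the rest of that path together with [s] joins
    the ends of [t]. *)
Lemma eqcl_exchange G s t : eqcl (add_pair G t) s.1 s.2 -> ~ eqcl G s.1 s.2 ->
  eqcl (add_pair G s) t.1 t.2.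
Proof.
have m u v : eqcl G u v -> eqcl (add_pair G s) u v.
  by apply: eqcl_mono => ? ?; left.
have S := @rst_sym V (add_pair G s).
have step : eqcl (add_pair G s) s.1 s.2 by apply: rst_step; right; case: (s).
case/eqcl_add_pair=> [//|[/m a /m b]|[/m a /m b]] _.
  by apply: rst_trans (S _ _ a) _; apply: rst_trans step (S _ _ b).
by apply: rst_trans b _; apply: rst_trans (S _ _ step) a.
Qed.

(** The edges of [I] form a forest once each component of [G] is contracted to a point. *)
Fixpoint independent G I : Prop :=
  if I is s :: I' then ~ eqcl G s.1 s.2 /\ independent (add_pair G s) I' else True.

(** The edge [t] that first connects the ends of [s] is the one that [s] replaces in the exchange
    argument. *)
Lemma first_spanning_prefix G s tau :
  eqcl (add_set G [set` tau]) s.1 s.2 -> ~ eqcl G s.1 s.2 ->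
  exists tau1 t tau2, [/\ tau = tau1 ++ t :: tau2,
    ~ eqcl (add_set G [set` tau1]) s.1 s.2 &
    eqcl (add_pair (add_set G [set` tau1]) t) s.1 s.2].
Proof.
elim/last_ind: tau => [|tau t IH] span nspan.
  by case: nspan; apply: eqcl_mono span => u v [|].
have [stau|nstau] := pselect (eqcl (add_set G [set` tau]) s.1 s.2).
  have [tau1 [t' [tau2 [-> ? ?]]]] := IH stau nspan.
  by exists tau1, t', (rcons tau2 t); rewrite rcons_cat.
exists tau, t, [::]; rewrite cats1; split=> //.
apply: eqcl_mono span => u v [?|/=]; first by left; left.
by rewrite mem_rcons inE => /predU1P[?|?]; [right|left; right].
Qed.

(* Steinitz exchange in the graphic matroid obtained by contracting [G]. *)
Lemma independent_leq_spanning G I tau : independent G I ->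
  (forall s, s \in I -> eqcl (add_set G [set` tau]) s.1 s.2) ->
  size I <= size tau.
Proof.
elim: I G tau => //= s I IH G tau [ns indI] span.
have [|tau1 [t [tau2 [tauE nspan1 span1]]]] := @first_spanning_prefix G s tau _ ns.
  by apply: span; rewrite inE eqxx.
rewrite tauE size_cat addnS ltnS -size_cat; apply: IH indI _ => s' s'I.
have := span s'; rewrite inE s'I orbT => /(_ isT); apply: eqcl_sub => u v.
case=> [Guv|]; first by apply: rst_step; left; left.
rewrite /= tauE mem_cat inE.
case/or3P=> [uv|/eqP tE|uv].
- by apply: rst_step; right; rewrite /= mem_cat uv.
- have := eqcl_exchange span1 nspan1; rewrite -tE /=.
  apply: eqcl_mono => a b [[?|ab]|?]; [by left; left| |by left; right].
  by right; rewrite /= mem_cat; apply/orP; left.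
- by apply: rst_step; right; rewrite /= mem_cat uv orbT.
Qed.

Lemma independentP G I : uniq I ->
  (forall s, s \in I -> ~ eqcl (add_set G [set r | r \in I /\ r <> s]) s.1 s.2) ->
  independent G I.
Proof.
elim: I G => //= s I IH G /andP[sI uI] ns; split.
  have := ns s; rewrite inE eqxx => /(_ isT) h e; apply: h.
  by apply: eqcl_mono e => ? ?; left.
apply: IH => // r rI; have := ns r; rewrite inE rI orbT => /(_ isT) h e; apply: h.
apply: eqcl_mono e => u v [[?|uv]|[uv ne]]; first by left.
  right; rewrite /= inE uv eqxx; split=> // sr.
  by move: sI; rewrite sr rI.
by right; rewrite /= inE uv orbT.
Qed.

End EquivalenceClosure.

(** Finiteness of [sigma] is part of the conclusion: every duplicate-free list drawn from it is
    independent, hence no longer than [tau]. *)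
Lemma irredundant_leq_spanning (V : choiceType) (G : V -> V -> Prop)
    (sigma : set (V * V)) (tau : seq (V * V)) :
  (forall s, sigma s -> ~ eqcl (add_set G (sigma `\ s)) s.1 s.2) ->
  (forall s, sigma s -> eqcl (add_set G [set` tau]) s.1 s.2) ->
  finite_set sigma /\ ncard sigma <= size tau.
Proof.
move=> irr span; apply: finite_set_bounded_size => I uI Isig.
apply: (@independent_leq_spanning _ G) => [|s /Isig]; last exact: span.
apply: independentP => // s sI e; apply: (irr s (Isig _ sI)).
apply: eqcl_mono e => u v [?|[uv ne]]; first by left.
by right; split=> //; exact: Isig.
Qed.

(** * Presentations as spanning edge sets, for nilsemigroups and semigroups at once *)

Section Presentations.
Variables (k : nat) (T : Type) (f : expvec k -> T) (nil : T -> Prop) (rank : T -> nat).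
Hypothesis f_add : forall a b c, f a = f b -> f (a + c)%R = f (b + c)%R.
Hypothesis f_cancel : forall a b c, ~ nil (f (a + c)%R) ->
  f (a + c)%R = f (b + c)%R -> f a = f b.
Hypothesis rank_lt : forall a c : expvec k, ~ nil (f (a + c)%R) -> c <> 0%R ->
  rank (f a) < rank (f (a + c)%R).

(* A common summand [c <> 0] is the same as intersecting supports. *)
Definition shared_support : expvec k -> expvec k -> Prop := fun a b =>
  exists a' b' c : expvec k, [/\ a = (a' + c)%R, b = (b' + c)%R, c <> 0%R,
    f a = f b & ~ nil (f a)].

Definition nonnil_kernel : set (expvec k * expvec k) :=
  [set ab | f ab.1 = f ab.2 /\ ~ nil (f ab.1)].

Definition spanning (rho : set (expvec k * expvec k)) : Prop :=
  forall a b, f a = f b -> ~ nil (f a) -> eqcl (add_set shared_support rho) a b.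

Lemma generating_set_spanning sigma : generating_set (kernel f) sigma ->
  spanning [set ab | sigma ab /\ ~ nil (f ab.1)].
Proof.
move=> gen; set rho := [set ab | _].
(* All translates are required to be connected so that [E] is a congruence. For a pair of [sigma],
   the translates by [c <> 0] share the support of [c], and the one by [0] lies in [rho]. *)
pose E : set (expvec k * expvec k) := [set ab | f ab.1 = f ab.2 /\
  forall c, ~ nil (f (ab.1 + c)%R) ->
    eqcl (add_set shared_support rho) (ab.1 + c)%R (ab.2 + c)%R].
have congE : congruence E.
  split=> [a|a b [/= ab h]|a b c [/= ab h] [/= bc h']|a b c [/= ab h]].
  - by split=> // c _; exact: rst_refl.
  - by split=> // c nn; apply/rst_sym/h; rewrite (f_add c ab).
  - split=> [|d nn]; first exact: etrans bc.
    by apply: (rst_trans _ _ _ _ _ (h _ nn)); apply: h'; rewrite -(f_add d ab).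
  - by split=> [|d] /=; [exact: f_add|rewrite -!addrA; exact: h].
have sigE : sigma `<=` E.
  move=> [a b] sab; have ab : f a = f b.
    suff : kernel f (a, b) by [].
    by rewrite -gen => C [_]; apply.
  split=> // c nn /=; apply: rst_step.
  have [c0|c0] := eqVneq c 0%R.
    by right; rewrite /rho /=; move: nn; rewrite /= c0 !addr0.
  left; exists a, b, c; split=> //; first exact/eqP.
  exact: f_add.
move=> a b ab nn; have : kernel f (a, b) by [].
rewrite -gen => /(smallest_sub congE sigE)[_ /= /(_ 0%R)].
by rewrite !addr0; apply.
Qed.

(** Induction on [rank]: the ends of an edge with shared support lose their common summand [c],
    which leaves a pair of smaller rank with equal values. The nil pairs, which a presentation
    discards, are all put back. *)
Lemma spanning_generating_set rho : rho `<=` nonnil_kernel -> spanning rho ->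
  generating_set (kernel f) (rho `|` [set ab | f ab.1 = f ab.2 /\ nil (f ab.1)]).
Proof.
move=> rhoK span; apply/seteqP; split.
  apply: smallest_sub => [|[a b] [/rhoK[]|[]]//].
  split=> [//|a b|a b c|a b c] /=.
  - by rewrite /kernel /= => ->.
  - by rewrite /kernel /= => ->.
  - exact: f_add.
move=> [a b] /= ab C [[Crefl Csym Ctrans Cadd] Csub].
have [n] := ubnP (rank (f a)); elim: n a b ab => // n IH a b ab.
rewrite ltnS => fn.
have [nn|nn] := pselect (nil (f a)); first by apply: Csub; right.
suff chain x y : eqcl (add_set shared_support rho) x y ->
    (rank (f x) <= n -> C (x, y)) /\ f x = f y.
  by have [/(_ fn)] := chain _ _ (span _ _ ab nn).
elim=> {a b ab fn nn x y} [a b|a|a b _ [h ab]|a b c _ [h ab] _ [h' bc]].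
- case=> [[a' [b' [c [-> -> c0 ab nn]]]]|rab].
    split=> // fn; apply: Cadd; apply: IH; first exact: f_cancel nn ab.
    exact: leq_trans (rank_lt nn c0) fn.
  by split=> [_|]; [apply: Csub; left|have [] := rhoK _ rab].
- by split.
- by rewrite -ab; split=> // /h; exact: Csym.
- split=> [fn|]; last exact: etrans bc.
  by apply: (Ctrans _ b); [exact: h|apply: h'; rewrite -ab].
Qed.

Lemma inclusion_minimal_leq_spanning P rho tau :
  (forall r, P r <-> r `<=` nonnil_kernel /\ spanning r) ->
  inclusion_minimal P rho -> spanning [set` tau] ->
  finite_set rho /\ ncard rho <= size tau.
Proof.
move=> PE [/PE[rhoK span] minrho] spant.
apply: (@irredundant_leq_spanning _ shared_support) => -[a b] rs; last first.
  by have [ab nn] := rhoK _ rs; exact: spant.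
move=> e; have : rho `\ (a, b) = rho.
  apply: minrho; last by move=> ? [].
  apply/PE; split=> [s [/rhoK]//|u v uv nn].
  apply: eqcl_sub (span u v uv nn) => x y [xy|xy].
    by apply: rst_step; left.
  have [[-> ->]//|ne] := pselect ((x, y) = (a, b)).
  by apply: rst_step; right; split.
by move=> /seteqP[_ /(_ _ rs)[_]]; apply.
Qed.

Lemma independent_leq_ncard I sigma : independent shared_support I ->
  [set` I] `<=` nonnil_kernel -> spanning sigma -> finite_set sigma ->
  size I <= ncard sigma.
Proof.
move=> ind IK span /finite_set_uniq_seq[s [us sE ->]].
apply: independent_leq_spanning ind _ => r /IK[rr nn].
by rewrite -sE; exact: span.
Qed.

End Presentations.

(** * Points of the Kunz cone and factorizations *)

Lemma truncated_add_ext m (P Q : 'Z_m -> 'Z_m -> Prop) :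
  (forall a b, P a b <-> Q a b) -> truncated_add P = truncated_add Q.
Proof.
move=> PQ; rewrite /truncated_add; apply/funext => -[a|//]; apply/funext => -[b|//].
by rewrite (propext (PQ a b)).
Qed.

Section KunzPoint.
Variables (R : realType) (m : nat).
Implicit Types (x : 'Z_m -> R) (y : {ffun 'Z_m -> R}).
Local Open Scope ring_scope.

(** Subadditivity can be asked of all pairs: where the cone imposes nothing, it follows from
    [x 0 = 0] and positivity. *)
Definition kunz_point x : Prop :=
  [/\ x 0 = 0, forall i, i != 0 -> 0 < x i & forall i j, x (i + j) <= x i + x j].

Definition nilop_of_point x : nilop m :=
  truncated_add (fun a b => x a + x b = x (a + b)).

(* For [m = 2] no inequality is imposed and the cone is a whole line. *)
Lemma kunz_cone_ge0 y (a b : 'Z_m) : kunz_cone y -> a != 0 -> b != 0 -> a + b != 0 ->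
  forall i, 0 <= y i.
Proof.
move=> [y0 ysub] a0 b0 ab0 i.
(* A least coordinate [y j], if negative, violates the inequality for [j + j], unless
   [j + j = 0]. *)
have [j _ jmin] := @Order.TotalTheory.arg_minP _ R 'Z_m i xpredT y isT.
apply: le_trans (jmin i isT); rewrite leNgt; apply/negP => yj.
have j0 : j != 0 by apply: contraTneq yj => ->; rewrite y0 ltxx.
have [jj|jj] := eqVneq (j + j) 0; last first.
  have := le_lt_trans (ysub _ _ j0 j0 jj) (_ : _ < y j).
  by rewrite -{3}[y j]addr0 ltrD2l => /(_ yj); rewrite ltNge jmin.
(* With [j + j = 0], passing from [l] to [j + l] and back gives [y l <= y l + 2 y j]. One of [a],
   [b] can serve as [l], since [a = b = j] would give [a + b = 0]. *)
have [l l0 lj] : exists2 l : 'Z_m, l != 0 & j + l != 0.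
  have [ja|ja] := eqVneq (j + a) 0; last by exists a.
  have [jb|jb] := eqVneq (j + b) 0; last by exists b.
  have aj : a = j by apply: (addrI j); rewrite ja jj.
  have bj : b = j by apply: (addrI j); rewrite jb jj.
  by case/eqP: ab0; rewrite aj bj.
have h1 := ysub _ _ j0 l0 lj.
have := ysub _ _ j0 lj; rewrite addrA jj add0r => /(_ l0) h2.
have := le_trans h2 (lerD (lexx (y j)) h1); rewrite addrA lerDr.
by rewrite leNgt => /negP; apply; rewrite -(addr0 0) ltrD.
Qed.

(** Summing finitely many suitable points of [F] gives a relative interior point, where a coordinate
    vanishes or an inequality is tight only if this holds on all of [F]. *)
Lemma kunz_nilsemigroup_point (N : nilop m) : kunz_nilsemigroup R N ->
  exists2 x, kunz_point x & N = nilop_of_point x.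
Proof.
case=> F [[c [c_ge0 FE]] triv ->].
have Fcone y : F y -> kunz_cone y by rewrite FE => -[].
have F0 : F 0.
  rewrite FE; split; first by split=> [|i j _ _ _]; rewrite !ffunE ?addr0.
  by rewrite big1 // => i _; rewrite ffunE mulr0.
have FD y z : F y -> F z -> F (y + z).
  rewrite FE => -[[y0 ys] cy] [[z0 zs] cz]; split.
    split=> [|i j i0 j0 ij0]; first by rewrite ffunE y0 z0 addr0.
    by rewrite !ffunE addrACA lerD ?ys ?zs.
  rewrite (eq_bigr (fun i => c i * y i + c i * z i)).
    by rewrite big_split /= cy cz addr0.
  by move=> i _; rewrite ffunE mulrDr.
have Fy0 y : F y -> y 0 = 0 by move=> /Fcone[].
(* If no such [a], [b] exist, the cone imposes no inequality and all nonzero residues coincide; the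
   value 1 there will do. *)
have [[a [b [a0 b0 ab0]]]|small] :=
    pselect (exists a b : 'Z_m, [/\ a != 0, b != 0 & a + b != 0]); last first.
  exists (fun i => (i != 0)%:R).
    split=> [|i ->|i j]; rewrite ?eqxx ?ltr01 //.
    rewrite -natrD ler_nat.
    have [->|i0] := eqVneq i 0; first by rewrite add0r.
    by case: (_ != 0).
  apply: truncated_add_ext => a b.
  have [->|a0] := eqVneq a 0.
    by rewrite !add0r; split=> // _ y /Fy0 ->; rewrite add0r.
  have [->|b0] := eqVneq b 0.
    by rewrite !addr0 a0; split=> // _ y /Fy0 ->; rewrite addr0.
  have opp (u v : 'Z_m) : u != 0 -> v != 0 -> u + v = 0.
    by move=> u0 v0; apply: contrapT => /eqP uv; apply: small; exists u, v.
  rewrite (opp a b) // eqxx; split=> [Fab|]; last first.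
    by move/eqP; rewrite -mulr2n pnatr_eq0.
  have ab : a = b by apply: (addrI a); rewrite !opp.
  case: (triv a a0) => y Fy; have := Fab y Fy; rewrite -ab Fy0 //.
  by move/eqP; rewrite -mulr2n mulrn_eq0 => /eqP.
have Fge0 y : F y -> forall i, 0 <= y i.
  by move=> /Fcone cy; exact: kunz_cone_ge0 cy a0 b0 ab0.
have Fsub y i j : F y -> 0 <= y i + y j - y (i + j).
  move=> Fy; have [_ ys] := Fcone _ Fy; rewrite subr_ge0.
  have [->|i0] := eqVneq i 0; first by rewrite add0r Fy0 ?add0r.
  have [->|j0] := eqVneq j 0; first by rewrite addr0 Fy0 ?addr0.
  have [->|ij0] := eqVneq (i + j) 0; last exact: ys.
  by rewrite Fy0 // addr_ge0 // Fge0.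
(* [u ij] avoids the hyperplane of the inequality [ij] unless all of [F] lies in it. *)
have /choice[u uP] (ij : 'Z_m * 'Z_m) : exists y, F y /\
    (y ij.1 + y ij.2 = y (ij.1 + ij.2) ->
     forall z, F z -> z ij.1 + z ij.2 = z (ij.1 + ij.2)).
  have [all|/existsNP[y /not_implyP[Fy yn]]] :=
    pselect (forall z, F z -> z ij.1 + z ij.2 = z (ij.1 + ij.2)).
    by exists 0.
  by exists y; split=> // /yn.
have /choice[v vP] i : exists y, F y /\ (i != 0 -> 0 < y i).
  have [->|i0] := eqVneq i 0; first by exists 0.
  have /existsNP[y /not_implyP[Fy /eqP yi]] := triv i i0.
  by exists y; rewrite lt_def yi Fge0.
pose x := \sum_(ij : 'Z_m * 'Z_m) (u ij + v ij.1).
have Fuv ij : F (u ij + v ij.1) by apply: FD; [have [] := uP ij|have [] := vP ij.1].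
have Fx : F x by rewrite /x; elim/big_ind: _.
exists x.
  split=> [|i i0|i j]; first exact: Fy0.
    rewrite sum_ffunE (bigD1 (i, 0)) //= ffunE.
    apply: ltr_wpDr; first by apply: sumr_ge0 => ij _; exact: Fge0.
    have [Fv /(_ i0) vi] := vP i; apply: ltr_wpDl vi.
    by apply: Fge0; have [] := uP (i, 0).
  by rewrite -subr_ge0 Fsub.
apply: truncated_add_ext => i j; split=> [|xij]; first exact.
have [_] := uP (i, j); apply; apply/eqP; rewrite -subr_eq0.
(* A sum of nonnegative slacks vanishes only if each of them does, in particular that of
   [u (i, j)]. *)
have := xij; rewrite /x !sum_ffunE => /eqP.
rewrite -subr_eq0 -big_split -sumrB /= psumr_eq0.
  move=> /allP /(_ (i, j)); rewrite mem_index_enum !ffunE /= => /(_ isT).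
  have Fv : F (v i) by have [] := vP i.
  have Fu : F (u (i, j)) by have [] := uP (i, j).
  rewrite [X in X - _]addrACA opprD [X in X == 0]addrACA paddr_eq0 ?Fsub //.
  by case/andP.
by move=> ij _; exact: Fsub.
Qed.

(** The face is cut out by the sum of all inequalities tight at [x]; [c] lists the coefficients of
    that sum. *)
Lemma point_kunz_nilsemigroup x : kunz_point x -> kunz_nilsemigroup R (nilop_of_point x).
Proof.
move=> [x0 xpos xsub].
pose tight := [pred ab : 'Z_m * 'Z_m | [&& ab.1 != 0, ab.2 != 0, ab.1 + ab.2 != 0 &
  x ab.1 + x ab.2 == x (ab.1 + ab.2)]].
pose c : {ffun 'Z_m -> R} := [ffun i => \sum_(ab | tight ab)
  ((ab.1 == i)%:R + (ab.2 == i)%:R - (ab.1 + ab.2 == i)%:R)].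
have pick (y : {ffun 'Z_m -> R}) i : i != 0 -> \sum_(j | j != 0) (i == j)%:R * y j = y i.
  move=> i0; rewrite (bigD1 i) //= eqxx mul1r big1 ?addr0 // => j /andP[_ ji].
  by rewrite eq_sym (negbTE ji) mul0r.
have cE (y : {ffun 'Z_m -> R}) : \sum_(i | i != 0) c i * y i =
    \sum_(ab | tight ab) (y ab.1 + y ab.2 - y (ab.1 + ab.2)).
  under eq_bigr do rewrite ffunE mulr_suml.
  rewrite exchange_big; apply: eq_bigr => -[a b] /and4P[/= a0 b0 ab0 _].
  under eq_bigr do rewrite mulrBl mulrDl.
  by rewrite sumrB big_split /= !pick.
have term_ge0 (y : {ffun 'Z_m -> R}) ab : kunz_cone y -> tight ab ->
    0 <= y ab.1 + y ab.2 - y (ab.1 + ab.2).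
  by move=> [_ ys] /and4P[a0 b0 ab0 _]; rewrite subr_ge0 ys.
pose F := [set y : {ffun 'Z_m -> R} | kunz_cone y /\ \sum_(i | i != 0) c i * y i = 0].
pose xf : {ffun 'Z_m -> R} := [ffun i => x i].
have Fx : F xf.
  split; first by split=> [|i j _ _ _]; rewrite !ffunE.
  rewrite cE big1 // => ab /and4P[_ _ _ /eqP e].
  by rewrite !ffunE e subrr.
exists F; split.
- exists c; split=> // y cy; rewrite cE; apply: sumr_ge0 => ab; exact: term_ge0.
- by move=> i i0 /(_ _ Fx); rewrite ffunE => xi; have := xpos i i0; rewrite xi ltxx.
apply: truncated_add_ext => a b; split=> [xab y [cy]|/(_ _ Fx)]; last first.
  by rewrite !ffunE.
have y0 : y 0 = 0 by case: cy.
have [->|a0] := eqVneq a 0; first by rewrite !add0r y0 add0r.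
have [->|b0] := eqVneq b 0; first by rewrite !addr0 y0 addr0.
have [ab0|ab0] := eqVneq (a + b) 0.
  have := addr_gt0 (xpos a a0) (xpos b b0).
  by rewrite xab ab0 x0 ltxx.
rewrite cE => /eqP; rewrite psumr_eq0; last by move=> ab; exact: term_ge0.
move=> /allP /(_ (a, b)); rewrite mem_index_enum /= a0 b0 ab0 xab eqxx /=.
by move=> /(_ isT); rewrite subr_eq0 => /eqP.
Qed.

End KunzPoint.

(** * Exponent vectors and additive maps on them *)

Section ExponentVectors.
Variable k : nat.
Implicit Types (a b c z : expvec k) (i : 'I_k).

Definition unit_vec i : expvec k := [ffun j => nat_of_bool (j == i)].

Lemma expvecD a b i : (a + b)%R i = a i + b i.
Proof. by rewrite ffunE. Qed.

Lemma expvec0 i : (0%R : expvec k) i = 0.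
Proof. by rewrite ffunE. Qed.

Lemma expvec_addIr c a b : (a + c)%R = (b + c)%R -> a = b.
Proof.
move=> /ffunP ab; apply/ffunP => i; have := ab i.
by rewrite !expvecD => /addIn.
Qed.

Lemma expvec_leP a b : (forall i, a i <= b i) -> exists c, b = (c + a)%R.
Proof.
move=> ab; exists [ffun i => b i - a i]; apply/ffunP => i.
by rewrite expvecD ffunE subnK.
Qed.

Lemma expvec_posP a i : reflect (exists b, a = (b + unit_vec i)%R) (0 < a i).
Proof.
apply: (iffP idP) => [ai|[b ->]]; last by rewrite expvecD ffunE eqxx addn1.
apply: expvec_leP => j; rewrite ffunE.
by case: eqP => [->|].
Qed.

Lemma expvec_neq0P a : a <> 0%R -> exists i, 0 < a i.
Proof.
move=> a0; apply: contrapT => /forallNP ai; apply: a0; apply/ffunP => i.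
by rewrite expvec0; apply/eqP; rewrite -leqn0 leqNgt; apply/negP.
Qed.

Lemma expvec_sub_unit a i :
  [ffun j => (a + unit_vec i)%R j - nat_of_bool (j == i)] = a.
Proof. by apply/ffunP => j; rewrite ffunE expvecD ffunE addnK. Qed.

Lemma expvec_ind (P : expvec k -> Prop) : P 0%R ->
  (forall a i, P a -> P (a + unit_vec i)%R) -> forall a, P a.
Proof.
move=> P0 PS a; have [n] := ubnP (\sum_i a i); elim: n a => // n IH a.
rewrite ltnS => an; have [->//|/eqP/expvec_neq0P[i ai]] := eqVneq a 0%R.
have /expvec_posP[b aE] := ai; rewrite aE; apply/PS/IH.
apply: leq_trans an; rewrite [leqRHS](eq_bigr (fun j => b j + unit_vec i j)).
  by rewrite big_split /= -[X in X < _]addn0 ltn_add2l (bigD1 i) //= ffunE eqxx.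
by move=> j _; rewrite aE expvecD.
Qed.

Lemma finite_expvec n : finite_set [set a : expvec k | forall i, a i <= n].
Proof.
pose h (u : {ffun 'I_k -> 'I_n.+1}) : expvec k := [ffun i => val (u i)].
apply: (@sub_finite_set _ _ (h @` setT)) => [a /= an|]; last first.
  exact/finite_image/finite_finset.
exists [ffun i => inord (a i)] => //; apply/ffunP => i.
by rewrite !ffunE /= inordK // ltnS.
Qed.

Section Linear.
Variables (V : nmodType) (c : 'I_k -> V).
Local Open Scope ring_scope.

(** The additive extension of [c]; residues, weights, degrees and embeddings are all of this
    form. *)
Definition lin z : V := \sum_i c i *+ z i.

Lemma lin0 : lin 0 = 0.
Proof. by rewrite /lin big1 // => i _; rewrite expvec0 mulr0n. Qed.

Lemma linD a b : lin (a + b) = lin a + lin b.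
Proof. by rewrite -big_split /=; apply: eq_bigr => i _; rewrite expvecD mulrnDr. Qed.

Lemma lin_unit i : lin (unit_vec i) = c i.
Proof.
rewrite /lin (bigD1 i) //= ffunE eqxx big1 ?addr0 // => j /negbTE ji.
by rewrite ffunE ji mulr0n.
Qed.

End Linear.
End ExponentVectors.

(** * Residues, weights and factorizations at a point of the cone *)

Definition atom_residue (m k : nat) (p : k.-tuple (option 'Z_m)) (i : 'I_k) : 'Z_m :=
  odflt 0%R (tnth p i).

Definition residue (m k : nat) (p : k.-tuple (option 'Z_m)) : expvec k -> 'Z_m :=
  lin (atom_residue p).

Definition weight (R : realType) (m k : nat) (p : k.-tuple (option 'Z_m))
  (x : 'Z_m -> R) : expvec k -> R := lin (x \o atom_residue p).

Definition nonnil (R : realType) (m k : nat) (p : k.-tuple (option 'Z_m))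
  (x : 'Z_m -> R) (z : expvec k) : Prop := weight p x z = x (residue p z).

Section Factorizations.
Variables (R : realType) (m k : nat) (hm : 1 < m) (p : k.-tuple (option 'Z_m)).
Variable x : 'Z_m -> R.
Hypothesis kx : kunz_point x.
Hypothesis hp : enumerates p (atoms (nilop_of_point x)).
Local Notation N := (nilop_of_point x).
Local Notation a := (atom_residue p).
Local Notation res := (residue p).
Local Notation wt := (weight p x).
Local Notation nonnil := (nonnil p x).
Implicit Types (z c b : expvec k) (q : 'Z_m) (i : 'I_k).
Local Open Scope ring_scope.

Lemma nilop_of_pointE q q' : N (Some q) (Some q') =
  if x q + x q' == x (q + q') then Some (q + q') else None.
Proof.
rewrite /nilop_of_point /truncated_add.
by case: eqP => e; rewrite ?(asboolT e) ?(asboolF e).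
Qed.

Lemma tnth_atom i : atoms N (tnth p i).
Proof. by case: hp => _ <-; rewrite /= mem_tnth. Qed.

(** The nil element is its own sum with itself, hence not an atom, and the default of [atom_residue]
    is never taken. *)
Lemma tnth_atom_residue i : tnth p i = Some (a i).
Proof.
rewrite /atom_residue; have [_] : atoms N (tnth p i) := tnth_atom i.
by case: (tnth p i) => // h; case: (h None None).
Qed.

Lemma atom_residue_inj : injective a.
Proof.
move=> i j aij; have [up _] := hp.
have : tnth p i = tnth p j by rewrite !tnth_atom_residue aij.
by move/tuple_uniqP: up; apply.
Qed.

Lemma atom_residue_neq0 i : a i != 0.
Proof.
have [] := tnth_atom i; rewrite tnth_atom_residue => ai _.
by apply/eqP => a0; apply: ai; rewrite a0.
Qed.

Lemma atom_residue_irreducible i q q' : q != 0 -> q' != 0 -> q + q' = a i ->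
  x q + x q' <> x (q + q').
Proof.
move=> q0 q'0 qq' e; have [_] := tnth_atom i.
move=> /(_ (Some q) (Some q')); rewrite nilop_of_pointE e eqxx qq' tnth_atom_residue.
by apply=> // -[] /eqP; rewrite ?(negbTE q0) ?(negbTE q'0).
Qed.

Lemma atom_or_sum q : q != 0 -> (exists i, a i = q) \/
  exists b c : 'Z_m, [/\ b != 0, c != 0, q = b + c & x b + x c = x q].
Proof.
move=> q0; have [|natq] := pselect (atoms N (Some q)).
  have [_ <-] := hp; rewrite /= => /tnthP[i qi]; left; exists i.
  by move: qi; rewrite tnth_atom_residue => -[].
right; apply: contrapT => h; apply: natq; split=> [[/eqP]|]; first exact/negP.
move=> [b|] [c|] // b0 c0; rewrite nilop_of_pointE; case: eqP => // e [bc].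
apply: h; exists b, c; rewrite -bc; split=> //.
  by apply/eqP => bz; apply: b0; rewrite bz.
by apply/eqP => cz; apply: c0; rewrite cz.
Qed.

Lemma point_ge0 q : 0 <= x q.
Proof.
have [x0 xpos _] := kx; have [->|/xpos/ltW//] := eqVneq q 0.
by rewrite x0.
Qed.

Lemma weight_ge z : x (res z) <= wt z.
Proof.
have [x0 _ xsub] := kx; elim/expvec_ind: z => [|z i IH].
  by rewrite /weight /residue !lin0 x0.
rewrite /weight /residue !linD !lin_unit.
exact: le_trans (xsub _ _) (lerD IH (lexx _)).
Qed.

(** [weight_ge] for both summands and subadditivity add up to [weight_ge] for the sum, so equality
    there forces equality in all three. *)
Lemma nonnilD z c : nonnil (z + c) <->
  [/\ nonnil z, nonnil c & x (res z) + x (res c) = x (res z + res c)].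
Proof.
have [_ _ xsub] := kx; have := weight_ge z; have := weight_ge c.
have := xsub (res z) (res c).
rewrite /nonnil /weight /residue !linD => xs wc wz; split=> [e|[-> -> ->]//].
have zE : lin (x \o a) z = x (lin a z).
  apply/le_anti; rewrite wz andbT -(lerD2r (lin (x \o a) c)) e.
  by apply: le_trans xs _; rewrite lerD2l.
have cE : lin (x \o a) c = x (lin a c).
  apply/le_anti; rewrite wc andbT -(lerD2l (lin (x \o a) z)) e.
  by rewrite zE.
by split=> //; rewrite -zE -cE.
Qed.

Lemma nonnil0 : nonnil 0.
Proof. by have [x0 _ _] := kx; rewrite /nonnil /weight /residue !lin0 x0. Qed.

Lemma nonnil_unit i : nonnil (unit_vec i).
Proof. by rewrite /nonnil /weight /residue !lin_unit. Qed.

Lemma nonnil_lt z : ~ nonnil z -> x (res z) < wt z.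
Proof. by move=> /eqP nz; rewrite lt_def nz weight_ge. Qed.

Lemma factorization_mapE z :
  factorization_map N p z = if `[< nonnil z >] then Some (res z) else None.
Proof.
have [x0 _ xsub] := kx.
(* [u] is the value of an expression of residue [r] and weight [v]. An excess of the weight over
   [x], once acquired, is never lost. *)
pose ok (u : option 'Z_m) (r : 'Z_m) (v : R) :=
  x r <= v /\ u = if v == x r then Some r else None.
have okD u r v u' r' v' : ok u r v -> ok u' r' v' -> ok (N u u') (r + r') (v + v').
  move=> [rv ->] [rv' ->]; split; first exact: le_trans (xsub r r') (lerD rv rv').
  have xs := xsub r r'.
  have [->|nv] := eqVneq v (x r); have [->|nv'] := eqVneq v' (x r').
  - by rewrite nilop_of_pointE.
  - rewrite gt_eqF //; apply: le_lt_trans xs _.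
    by rewrite ltrD2l lt_def nv'.
  - rewrite gt_eqF //; apply: le_lt_trans xs _.
    by rewrite ltrD2r lt_def nv.
  - rewrite gt_eqF //; apply: le_lt_trans xs _.
    by rewrite ltrD // lt_def ?nv ?nv'.
have ok0 : ok (Some 0) 0 0 by split; rewrite x0 ?eqxx.
have : ok (factorization_map N p z) (res z) (wt z).
  rewrite /factorization_map /residue /weight /lin.
  elim/big_rec3: _ => // i v r u _; apply: (okD).
  elim: (z i) => [|n IH]; first by rewrite !mulr0n.
  rewrite iterS !mulrS; apply: okD IH; rewrite tnth_atom_residue.
  by split; rewrite /= ?eqxx.
by case=> _ ->; case: eqP => e; rewrite ?(asboolT e) ?(asboolF e).
Qed.

Lemma factorizations_Some q z : factorizations N p (Some q) z <-> nonnil z /\ res z = q.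
Proof.
rewrite /factorizations /= factorization_mapE.
by case: asboolP => h; split=> [|[]] //; [case=> ->|move=> _ ->].
Qed.

Lemma factorizations_None z : factorizations N p None z <-> ~ nonnil z.
Proof.
by rewrite /factorizations /= factorization_mapE; case: asboolP => h; split=> // /(_ h).
Qed.

Definition point_rank q : nat := #|[set j | x j < x q]%SET|.

Lemma point_rank_lt q q' : x q < x q' -> (point_rank q < point_rank q')%N.
Proof.
move=> qq'; apply: proper_card; apply/properP; split.
  by apply/fintype.subsetP => j; rewrite !inE => /lt_trans; apply.
by exists q; rewrite !inE // ltxx.
Qed.

(** A nonzero element that is not an atom splits into two of smaller [x], whose factorizations add
    up. *)
Lemma nonnil_exists q : exists2 z, nonnil z & res z = q.
Proof.
have [x0 xpos xsub] := kx.
have [n] := ubnP (point_rank q); elim: n q => // n IH q; rewrite ltnS => qn.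
have [->|q0] := eqVneq q 0.
  by exists 0; [exact: nonnil0|rewrite /residue lin0].
have [[i <-]|[b [c [b0 c0 qE e]]]] := atom_or_sum q0.
  by exists (unit_vec i); [exact: nonnil_unit|rewrite /residue lin_unit].
have bq : x b < x q by rewrite -e ltrDl xpos.
have cq : x c < x q by rewrite -e ltrDr xpos.
have [z nz zb] := IH b (leq_trans (point_rank_lt bq) qn).
have [z' nz' zc] := IH c (leq_trans (point_rank_lt cq) qn).
exists (z + z'); last by rewrite /residue linD qE -zb -zc.
by apply/nonnilD; rewrite zb zc -qE.
Qed.

Lemma residue_neq0 z : nonnil z -> z <> 0 -> res z != 0.
Proof.
have [x0 xpos xsub] := kx; move=> nz /expvec_neq0P[i /expvec_posP[c zE]].
move: nz; rewrite zE => /nonnilD[_ _]; rewrite /residue linD lin_unit => e.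
apply/eqP => e0; have := xpos _ (atom_residue_neq0 i).
apply/negP; rewrite -leNgt; apply: le_trans (_ : x (lin a c + a i) <= 0).
  by rewrite -e lerDr point_ge0.
by rewrite e0 x0.
Qed.

(** The multiples [u n] of a generator with [n <= z i] are non-nil and have distinct residues, since
    a nonzero non-nil vector, such as the difference of two of them, has nonzero residue. These are
    [z i + 1] vectors for [m] residues. *)
Lemma nonnil_bounded z i : nonnil z -> (z i < m)%N.
Proof.
move=> nz; have [x0 xpos _] := kx.
pose u n : expvec k := [ffun j => if j == i then n else 0%N].
have uD n n' : u (n + n')%N = u n + u n'.
  by apply/ffunP => j; rewrite expvecD !ffunE; case: eqP.
have un n : (n <= z i)%N -> nonnil (u n).
  move=> ni; have /expvec_leP[c zE] : forall j, (u n j <= z j)%N.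
    by move=> j; rewrite ffunE; case: eqP => // ->.
  by move: nz; rewrite zE => /nonnilD[].
have inj : injective (fun n : 'I_(z i).+1 => res (u n)).
  suff lt (n n' : nat) : (n' <= z i)%N -> (n < n')%N -> res (u n) <> res (u n').
    have le (j : 'I_(z i).+1) : (j <= z i)%N by rewrite -ltnS ltn_ord.
    move=> n n' e; case: (ltngtP n n') => [h|h|/val_inj//].
      by case: (lt _ _ (le n') h e).
    by case: (lt _ _ (le n) h (esym e)).
  move=> n'z nn' /eqP; rewrite -(subnKC (ltnW nn')) uD /residue linD -subr_eq0.
  rewrite opprD addNKr oppr_eq0 => /eqP e0.
  have := @residue_neq0 (u (n' - n)%N); rewrite /residue e0 eqxx => h.
  suff : false by []. apply: h.
    by apply: un; rewrite (leq_trans (leq_subr _ _)).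
  move=> /ffunP /(_ i); rewrite expvec0 ffunE eqxx => /eqP.
  by rewrite subn_eq0 leqNgt nn'.
have := leq_card _ inj; rewrite !card_ord => zi.
by rewrite (leq_trans zi) // Zp_cast.
Qed.

Lemma nonnil_replace c b b' : nonnil (c + b) -> nonnil b' -> res b = res b' ->
  nonnil (c + b').
Proof. by move=> /nonnilD[nc nb e] nb' bb'; apply/nonnilD; rewrite -bb'. Qed.

Lemma residue_replace c b b' : res b = res b' -> res (c + b) = res (c + b').
Proof. by rewrite /residue !linD => ->. Qed.

Lemma finite_nonnil : finite_set (nonnil : set (expvec k)).
Proof.
apply: sub_finite_set (finite_expvec k m) => z nz i /=.
exact/ltnW/nonnil_bounded.
Qed.

End Factorizations.

(** * Existence of a staircase refinement *)

Lemma radix_inj (m k : nat) (u v : 'I_k -> nat) :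
  (forall i, u i < m) -> (forall i, v i < m) ->
  \sum_i u i * m ^ i = \sum_i v i * m ^ i -> u =1 v.
Proof.
elim: k u v => [u v _ _ _ []//|k IH u v um vm]; rewrite !big_ord_recl !expn0 !muln1.
have step (w : 'I_k.+1 -> nat) : \sum_(i < k) w (lift ord0 i) * m ^ lift ord0 i =
    (\sum_(i < k) w (lift ord0 i) * m ^ i) * m.
  by rewrite big_distrl; apply: eq_bigr => i _; rewrite expnSr mulnA.
rewrite !step => e.
have m0 : 0 < m by exact: leq_ltn_trans (um ord0).
have e0 : u ord0 = v ord0.
  by have := congr1 (modn^~ m) e; rewrite !(addnC _ (_ * m)) !modnMDl !modn_small.
move: e; rewrite e0 => /addnI /eqP; rewrite eqn_pmul2r // => /eqP e i.
case: (unliftP ord0 i) => [j ->|->//].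
by move: j; apply: IH => // j.
Qed.

Section StaircaseRefinement.
Variables (R : realType) (m k : nat) (hm : 1 < m) (p : k.-tuple (option 'Z_m)).
Variable x : 'Z_m -> R.
Hypothesis kx : kunz_point x.
Hypothesis hp : enumerates p (atoms (nilop_of_point x)).
Local Notation a := (atom_residue p).
Local Notation res := (residue p).
Local Open Scope ring_scope.

(** A generator split off a longer factorization would make the atom a sum of two nonzero
    elements. *)
Lemma nonnil_atom z i : nonnil p x z -> res z = a i -> z = unit_vec i.
Proof.
move=> nz zi; have z0 : z <> 0.
  by move=> z0; have := atom_residue_neq0 hp i; rewrite -zi z0 /residue lin0 eqxx.
have [j /expvec_posP[c zE]] := expvec_neq0P z0.
move: nz zi; rewrite zE => /(nonnilD p kx)[nc _]; rewrite /residue linD lin_unit => e ci.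
have [c0|/eqP c0] := eqVneq c 0.
  by move: ci; rewrite c0 lin0 !add0r => /(atom_residue_inj hp) ->.
have := atom_residue_irreducible hp (residue_neq0 kx hp nc c0)
  (atom_residue_neq0 hp j) ci.
by rewrite e.
Qed.

(** [d] is the smallest gap among the strict inequalities divided by [K + 1], so that [d * K] stays
    below every gap. *)
Lemma exists_separation (K : R) : 0 <= K -> exists2 d : R, 0 < d &
  forall i j : 'Z_m, x i + x j <> x (i + j) -> x (i + j) + d * K < x i + x j.
Proof.
move=> K0; have [_ _ xsub] := kx.
pose G := [set ij : 'Z_m * 'Z_m | x ij.1 + x ij.2 <> x (ij.1 + ij.2)].
have [G0|noG] := pselect (G !=set0); last first.
  by exists 1 => // i j ij; case: noG; exists (i, j).
pose gap (ij : 'Z_m * 'Z_m) : R := x ij.1 + x ij.2 - x (ij.1 + ij.2).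
have [ij Gij gmin] := finite_set_min gap (finite_finset : finite_set G) G0.
have gap_gt0 : 0 < gap ij.
  by rewrite subr_gt0 lt_def xsub andbT; apply/eqP.
have K1 : 0 < K + 1 by rewrite ltr_wpDl.
exists (gap ij / (K + 1)) => [|i j ne]; first by rewrite divr_gt0.
rewrite -ltrBrDl; apply: lt_le_trans (gmin (i, j) ne).
by rewrite -mulrA gtr_pMr // mulrC ltr_pdivrMr // mul1r ltrDl.
Qed.

(* Among the factorizations of each element, keep the one that minimizes the
   injective weight [z |-> sum_i z_i m^i]; adding a small multiple of that
   minimum to [x] makes it the only factorization. *)
Lemma exists_staircase : exists x' : 'Z_m -> R,
  [/\ kunz_point x', atoms (nilop_of_point x) = atoms (nilop_of_point x'),
      forall z, nonnil p x' z -> nonnil p x z &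
      forall z z', nonnil p x' z -> nonnil p x' z' -> res z = res z' -> z = z'].
Proof.
have [x0 xpos xsub] := kx.
pose W : expvec k -> nat := lin (fun i : 'I_k => (m ^ i)%N).
have WD z z' : W (z + z') = (W z + W z')%N by exact: linD.
have Winj z z' : nonnil p x z -> nonnil p x z' -> W z = W z' -> z = z'.
  move=> nz nz' e; apply/ffunP; apply: (@radix_inj m).
  - by move=> i; exact: (nonnil_bounded hm kx hp).
  - by move=> i; exact: (nonnil_bounded hm kx hp).
  - have WE y : W y = (\sum_i y i * m ^ i)%N.
      apply: eq_bigr => i _; rewrite mulnC.
      by elim: (y i) => [|n IH]; rewrite ?mulr0n ?muln0 // mulrS IH mulnS.
    by rewrite -!WE.
have /choice[t tP] q : exists z, [/\ nonnil p x z, res z = q &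
    forall z', nonnil p x z' -> res z' = q -> (W z <= W z')%N].
  pose A := [set z | nonnil p x z /\ res z = q].
  have fA : finite_set A.
    by apply: sub_finite_set (finite_nonnil hm kx hp) => z [].
  have A0 : A !=set0 by have [z] := nonnil_exists kx hp q; exists z.
  have [z [nz zq] zmin] := finite_set_min (fun z => (W z)%:R : R) fA A0.
  exists z; split=> // z' nz' z'q; rewrite -(ler_nat R); exact: zmin.
have tn q : nonnil p x (t q) by case: (tP q).
have tr q : res (t q) = q by case: (tP q).
have tmin z : nonnil p x z -> (W (t (res z)) <= W z)%N.
  by move=> nz; case: (tP (res z)) => _ _; apply.
pose K : R := \sum_q (W (t q))%:R.
have tK q : (W (t q))%:R <= K.
  by rewrite /K (bigD1 q) //= lerDl sumr_ge0.
have K0 : 0 <= K by rewrite sumr_ge0.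
have [d d0 dP] := exists_separation K0.
pose x' q : R := x q + d * (W (t q))%:R.
have x'lt i j : x i + x j <> x (i + j) -> x' (i + j) < x' i + x' j.
  move=> /dP ij; apply: le_lt_trans (_ : _ <= x (i + j) + d * K) _.
    by rewrite lerD2l ler_pM2l.
  apply: lt_le_trans ij _; rewrite /x' addrACA lerDl -mulrDr.
  by rewrite mulr_ge0 ?(ltW d0) // addr_ge0 // ler0n.
have tt i j : x i + x j = x (i + j) -> nonnil p x (t i + t j).
  by move=> ij; apply/(nonnilD p kx); split=> //; rewrite !tr.
have ttW i j : x i + x j = x (i + j) -> (W (t (i + j)%R) <= W (t i) + W (t j))%N.
  by move=> /tt /tmin; rewrite /residue linD -/(res _) -/(res _) !tr WD.
have x'E i j : x i + x j = x (i + j) -> x' i + x' j - x' (i + j) =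
    d * ((W (t i) + W (t j))%:R - (W (t (i + j)))%:R).
  by move=> ij; rewrite /x' -ij natrD; ring.
(* An inequality tight for [x] stays tight for [x'] exactly when [W] adds up on the chosen
   factorizations, that is, as [W] is injective, when these themselves add up. *)
have tight' i j : x' i + x' j = x' (i + j) <->
    x i + x j = x (i + j) /\ t i + t j = t (i + j).
  split=> [e|[ij e]]; last first.
    by apply/eqP; rewrite -subr_eq0 x'E // -WD e subrr mulr0.
  have ij : x i + x j = x (i + j).
    by apply: contrapT => /x'lt; rewrite e ltxx.
  split=> //; apply: Winj; [exact: tt|exact: tn|].
  have /eqP := x'E _ _ ij; rewrite e subrr eq_sym mulf_eq0 gt_eqF //= subr_eq0.
  by rewrite eqr_nat WD => /eqP.
have t0 : t 0 = 0.
  by apply: contrapT => /(residue_neq0 kx hp (tn 0)); rewrite tr eqxx.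
have kx' : kunz_point x'.
  split=> [|i i0|i j].
  - by rewrite /x' t0 /W lin0 mulr0 addr0.
  - by rewrite ltr_wpDr ?xpos // mulr_ge0 ?(ltW d0) ?ler0n.
  - have [ij|/x'lt/ltW//] := pselect (x i + x j = x (i + j)).
    by rewrite -subr_ge0 x'E // mulr_ge0 ?(ltW d0) // subr_ge0 ler_nat ttW.
have ta i : t (a i) = unit_vec i by apply: nonnil_atom.
(* Choices are closed under removing a generator: a lighter factorization of the rest would give a
   lighter one of the whole. *)
have tsub z i q : t q = z + unit_vec i -> z = t (res z).
  move=> tq; have := tn q; rewrite tq => nz.
  have [nz1 _ _] := (nonnilD p kx _ _).1 nz; apply: Winj => //.
  apply/eqP; rewrite eqn_leq tmin // andbT -(leq_add2r (W (unit_vec i))) -!WD.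
  rewrite -tq -[q in t q]tr tq.
  have zr : res z = res (t (res z)) by rewrite tr.
  have -> : res (z + unit_vec i) = res (t (res z) + unit_vec i).
    by rewrite /residue !linD -!/(res _) tr.
  apply: tmin; apply/(nonnilD p kx); rewrite tr.
  by have [_ ? ?] := (nonnilD p kx _ _).1 nz.
have atomsE : atoms (nilop_of_point x) = atoms (nilop_of_point x').
  apply/seteqP; split=> -[q|] [q0 irr]; split=> //.
  - move=> [b|] [c|] b0 c0 //; rewrite nilop_of_pointE; case: eqP => // /tight'[bc _].
    by have := irr _ _ b0 c0; rewrite nilop_of_pointE bc eqxx.
  - by case: (irr None None).
  (* If [q] is not an atom for [x], removing a generator from [t q] splits [q] tightly for [x'] as
     well, by [tsub]. *)
  - have tq0 : t q <> 0.
      by move=> tq0; apply: q0; rewrite -(tr q) tq0 /residue lin0.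
    have [j /expvec_posP[c tE]] := expvec_neq0P tq0.
    have := tn q; rewrite tE => /(nonnilD p kx)[nc _]; rewrite /residue lin_unit => e.
    have [c0|/eqP c0] := eqVneq c 0.
      have -> : q = a j by rewrite -(tr q) tE c0 add0r /residue lin_unit.
      by rewrite -(tnth_atom_residue hp); have [] := tnth_atom hp j.
    have qE : q = res c + a j by rewrite -[LHS]tr tE /residue linD lin_unit.
    case: (irr (Some (res c)) (Some (a j))).
    + by move=> [] /eqP; rewrite (negbTE (residue_neq0 kx hp nc c0)).
    + by move=> [] /eqP; rewrite (negbTE (atom_residue_neq0 hp j)).
    + rewrite nilop_of_pointE; case: eqP => [|[]]; first by rewrite -qE.
      by apply/tight'; split=> //; rewrite -(tsub _ _ _ tE) ta -tE qE.
  - by case: (irr None None).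
have nonnilE z : nonnil p x' z -> z = t (res z).
  elim/expvec_ind: z => [_|z i IH /(nonnilD p kx')[nz _ /tight'[_]]].
    by rewrite /residue lin0 t0.
  by rewrite -(IH nz) /residue linD lin_unit ta.
exists x'; split=> // [z /nonnilE ->|z z' /nonnilE {2}-> /nonnilE {2}-> ->] //.
Qed.

End StaircaseRefinement.

(** * Presentations and outer Betti elements of nilsemigroups *)

Section NilsemigroupPresentations.
Variables (R : realType) (m k : nat) (p : k.-tuple (option 'Z_m)).
Variable x : 'Z_m -> R.
Hypothesis kx : kunz_point x.
Hypothesis hp : enumerates p (atoms (nilop_of_point x)).
Local Notation N := (nilop_of_point x).
Local Notation res := (residue p).
Local Notation nonnil := (nonnil p x).
Local Notation f := (factorization_map N p).
Local Notation nil := (fun u : option 'Z_m => u = None).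
Implicit Types (a b c z : expvec k).
Local Open Scope ring_scope.

Definition nilop_rank (u : option 'Z_m) : nat :=
  if u is Some q then point_rank x q else 0%N.

Lemma factorization_map_nonnil z : f z <> None <-> nonnil z.
Proof. by rewrite (factorization_mapE kx hp); case: asboolP. Qed.

Lemma factorization_map_eq z z' : nonnil z -> nonnil z' ->
  f z = f z' <-> res z = res z'.
Proof.
move=> nz nz'; rewrite !(factorization_mapE kx hp) !asboolT //.
by split=> [[]|->].
Qed.

Lemma factorization_map_add a b c : f a = f b -> f (a + c) = f (b + c).
Proof.
move=> ab; have nab : nonnil a <-> nonnil b by rewrite -!factorization_map_nonnil ab.
have res_ab : nonnil a -> res a = res b.
  by move=> na; rewrite -factorization_map_eq // -nab.
have nabc : nonnil (a + c) <-> nonnil (b + c).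
  split=> n; have [na _ _] := (nonnilD p kx _ _).1 n.
    by move: n; rewrite ![_ + c]addrC => /(nonnil_replace kx); apply; [exact/nab|exact: res_ab].
  have na' := nab.2 na.
  by move: n; rewrite ![_ + c]addrC => /(nonnil_replace kx); apply; [|rewrite res_ab].
have [n|n] := pselect (nonnil (a + c)).
  apply/factorization_map_eq => //; first exact/nabc.
  have [na _ _] := (nonnilD p kx _ _).1 n.
  by rewrite ![_ + c]addrC; apply/residue_replace/res_ab.
rewrite !(factorization_mapE kx hp) !asboolF //.
by rewrite -nabc.
Qed.

Lemma factorization_map_cancel a b c : f (a + c) <> None ->
  f (a + c) = f (b + c) -> f a = f b.
Proof.
move=> n e; have nb : f (b + c) <> None by rewrite -e.
move: n nb e => /factorization_map_nonnil n /factorization_map_nonnil n'.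
move/factorization_map_eq => /(_ n n'); rewrite /residue !linD => /addIr e.
have [na _ _] := (nonnilD p kx _ _).1 n; have [nb _ _] := (nonnilD p kx _ _).1 n'.
exact/factorization_map_eq.
Qed.

Lemma nilop_rank_lt a c : f (a + c) <> None -> c <> 0 ->
  (nilop_rank (f a) < nilop_rank (f (a + c)%R))%N.
Proof.
have [x0 xpos _] := kx.
move=> /factorization_map_nonnil n c0; have [na nc e] := (nonnilD p kx _ _).1 n.
rewrite !(factorization_mapE kx hp) !asboolT //=; apply: point_rank_lt.
rewrite /residue linD -e ltrDl; apply: xpos.
exact (residue_neq0 kx hp nc c0).
Qed.

(** Any generating set may be enlarged by all nil pairs, so all that matters of it is whether its
    remaining pairs span. *)
Lemma presentationP rho : presentation N p rho <->
  rho `<=` nonnil_kernel f nil /\ spanning f nil rho.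
Proof.
split=> [[sigma [gen ->]]|[rhoK span]].
  split; last exact (generating_set_spanning (nil := nil) factorization_map_add gen).
  move=> [a b] [sab nn]; split=> //=.
  by have : kernel f (a, b) by rewrite -gen => C [_]; apply.
exists (rho `|` [set ab | f ab.1 = f ab.2 /\ f ab.1 = None]); split.
  exact (spanning_generating_set (nil := nil) factorization_map_add
    factorization_map_cancel nilop_rank_lt rhoK span).
apply/seteqP; split=> [ab rab|ab [[//|[_ ->]]//]].
by split; [left|have [] := rhoK _ rab].
Qed.

End NilsemigroupPresentations.

(** * Outer Betti elements *)

Section OuterBetti.
Variables (R : realType) (m k : nat) (hm : 1 < m) (p : k.-tuple (option 'Z_m)).
Variable x : 'Z_m -> R.
Hypothesis kx : kunz_point x.
Hypothesis hp : enumerates p (atoms (nilop_of_point x)).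
Local Notation N := (nilop_of_point x).
Local Notation res := (residue p).
Local Notation nonnil := (nonnil p x).
Implicit Types (B : set (expvec k)).
Local Open Scope ring_scope.

(** Condition (i) on outer Betti elements, with the truncated subtraction of [shift_down] replaced
    by addition of [unit_vec i]. *)
Lemma outer_betti_slice B i : outer_betti N p B -> suppB B i ->
  exists q, forall c, B (c + unit_vec i) <-> nonnil c /\ res c = q.
Proof.
move=> [_ Bsh _] Bi; have [q sh] := Bsh i Bi; exists q => c.
rewrite -(factorizations_Some kx hp) -sh; split=> [Bc|[z [Bz zi] <-]].
  exists (c + unit_vec i); last exact: expvec_sub_unit.
  by split=> //; apply/expvec_posP; exists c.
by have /expvec_posP[d zE] := zi; move: Bz; rewrite zE expvec_sub_unit.
Qed.

(** Membership in [B'] spreads along the edges of the graph on [B]: at a common generator [i] of [u]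
    and [v], the slices of [B] and [B'] belong to the same residue, because [u] lies in both sets,
    so they coincide. *)
Lemma outer_betti_sub B B' z : outer_betti N p B -> outer_betti N p B' ->
  B z -> B' z -> B `<=` B'.
Proof.
move=> oB oB' Bz B'z y By; have [_ _ [_ /(_ z y Bz By) path]] := oB.
elim: path B'z => // {z y Bz By} [u v [Bu Bv [i [ui vi]]] B'u|u v w _ IH _ IH' /IH//].
have [c uE] := expvec_posP _ _ ui; have [d vE] := expvec_posP _ _ vi.
have [q qP] := outer_betti_slice oB (ex_intro2 _ _ u Bu ui : suppB B i).
have [q' q'P] := outer_betti_slice oB' (ex_intro2 _ _ u B'u ui : suppB B' i).
move: Bu Bv B'u; rewrite uE vE => /qP[_ cq] /qP[nd dq] /q'P[_ cq'].
by apply/q'P; rewrite -cq' cq.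
Qed.

Lemma outer_betti_disjoint B B' z : outer_betti N p B -> outer_betti N p B' ->
  B z -> B' z -> B = B'.
Proof.
by move=> oB oB' Bz B'z; apply/seteqP; split;
  [exact: (outer_betti_sub oB oB' Bz B'z)|exact: (outer_betti_sub oB' oB B'z Bz)].
Qed.

(** Lowering a positive coordinate by one leaves a non-nil vector, whose coordinates are below
    [m]. *)
Lemma finite_outer_betti_element B : outer_betti N p B -> finite_set B.
Proof.
move=> oB; apply: sub_finite_set (finite_expvec k m) => z Bz i /=.
have [//|/expvec_posP[c zE]] := posnP (z i); first by move=> ->.
have Bi : suppB B i by exists z => //; apply/expvec_posP; exists c.
have [q qP] := outer_betti_slice oB Bi; move: Bz; rewrite zE => /qP[nc _].
by rewrite expvecD ffunE eqxx addn1 (nonnil_bounded hm kx hp).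
Qed.

End OuterBetti.

(** * Comparison of a nilsemigroup with a staircase refinement *)

Section Staircase.
Variables (R : realType) (m k : nat) (hm : 1 < m) (p : k.-tuple (option 'Z_m)).
Variables x x' : 'Z_m -> R.
Hypothesis kx : kunz_point x.
Hypothesis hp : enumerates p (atoms (nilop_of_point x)).
Hypothesis kx' : kunz_point x'.
Hypothesis hp' : enumerates p (atoms (nilop_of_point x')).
Hypothesis nonnil_sub : forall z, nonnil p x' z -> nonnil p x z.
Variable t : 'Z_m -> expvec k.
Hypothesis t_nonnil : forall q, nonnil p x' (t q).
Hypothesis t_residue : forall q, residue p (t q) = q.
Hypothesis nonnil_t : forall z, nonnil p x' z -> z = t (residue p z).
Local Notation N := (nilop_of_point x).
Local Notation N' := (nilop_of_point x').
Local Notation res := (residue p).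
Local Notation wt := (weight p x').
Implicit Types (b c z : expvec k).
Local Open Scope ring_scope.

(* Removing one generator at a time suffices for minimality among the nil vectors of
   [N'], since a summand of a non-nil vector is non-nil. *)
Definition minimal_nil b : Prop := ~ nonnil p x' b /\
  forall c i, b = c + unit_vec i -> nonnil p x' c.

Lemma minimal_nil_below z : ~ nonnil p x' z ->
  exists c b, minimal_nil b /\ z = c + b.
Proof.
have [n] := ubnP (lin (fun=> 1%N) z); elim: n z => // n IH z; rewrite ltnS => zn nz.
have [mz|] := pselect (minimal_nil z).
  by exists 0, z; rewrite add0r.
move=> /not_andP[//|/existsNP[d /existsNP[i /not_implyP[zE nd]]]].
have [|c [b [mb dE]]] := IH d _ nd.
  by apply: leq_trans zn; rewrite zE linD lin_unit addrC.
by exists (c + unit_vec i), b; split=> //; rewrite zE dE addrAC.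
Qed.

Lemma finite_minimal_nil : finite_set minimal_nil.
Proof.
apply: sub_finite_set (finite_expvec k m) => z [_ mz] i /=.
have [->//|/expvec_posP[c zE]] := posnP (z i).
by rewrite zE expvecD ffunE eqxx addn1 (nonnil_bounded hm kx' hp' i (mz _ _ zE)).
Qed.

(** A nil vector weighs more than [x'] at its residue, a weight that [t (res b)] attains. *)
Lemma weight_staircase_lt c b : ~ nonnil p x' b -> wt (c + t (res b)) < wt (c + b).
Proof.
move=> /(nonnil_lt kx') lt; rewrite /weight !linD ltrD2l.
by rewrite -/(wt _) -/(wt _) (t_nonnil (res b)) t_residue.
Qed.

(** The vector of least weight in [B] works. Were it a minimal nil [d] plus some [c] with [c i > 0],
    replacing [d] by [t (res d)] would stay in the slice of [B] at [i] and lower the weight. *)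
Lemma outer_betti_minimal_nil B : outer_betti N p B ->
  exists b, [/\ B b, minimal_nil b & ~ nonnil p x b].
Proof.
move=> oB; have [BN _ [B0 _]] := oB.
have [b Bb bmin] := finite_set_min wt (finite_outer_betti_element hm kx hp oB) B0.
have nb : ~ nonnil p x b by exact/(factorizations_None kx hp)/BN.
exists b; split=> //.
have [c [d [md bE]]] := minimal_nil_below (fun h => nb (nonnil_sub h)).
have [c0|/eqP/expvec_neq0P[i ci]] := eqVneq c 0; first by rewrite bE c0 add0r.
have bi : (0 < b i)%N by rewrite bE expvecD ltn_addr.
have [q qP] := outer_betti_slice kx hp oB (ex_intro2 _ _ b Bb bi : suppB B i).
have /expvec_posP[e cE] := ci.
move: Bb; rewrite bE cE addrAC => /qP[ned edq]; have [_ nd _] := (nonnilD p kx _ _).1 ned.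
have Bt : B (e + t (res d) + unit_vec i).
  apply/qP; split.
    by apply: (nonnil_replace kx ned (nonnil_sub (t_nonnil _))); rewrite t_residue.
  by rewrite -edq; apply: residue_replace; rewrite t_residue.
have := bmin _ Bt; rewrite bE cE [e + t _ + _]addrAC leNgt weight_staircase_lt //.
by case: md.
Qed.

(** Removing one generator from [b] leaves a non-nil vector, which is the only factorization of its
    residue in [N']. *)
Lemma minimal_nil_outer_betti b : minimal_nil b -> outer_betti N' p [set b].
Proof.
move=> [nb mb]; split.
- by move=> _ ->; apply/(factorizations_None kx' hp').
- move=> i [_ -> bi]; have /expvec_posP[c bE] := bi.
  exists (res c); apply/seteqP; split=> [_ [_ [-> _] <-]|z].
    rewrite bE expvec_sub_unit; apply/(factorizations_Some kx' hp'); split=> //.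
    exact: mb bE.
  move=> /(factorizations_Some kx' hp')[nz zc]; exists b; first by split.
  rewrite bE expvec_sub_unit [RHS](nonnil_t nz) zc; exact: nonnil_t (mb _ _ bE).
- split; first by exists b.
  by move=> _ _ -> ->; exact: rt_refl.
Qed.

Lemma ncard_outer_betti_nil : finite_set (outer_betti N p) /\
  (ncard (outer_betti N p) <= ncard [set b | minimal_nil b /\ ~ nonnil p x b])%N.
Proof.
have /choice[h hP] B : exists b, outer_betti N p B ->
    [/\ B b, minimal_nil b & ~ nonnil p x b].
  have [/outer_betti_minimal_nil[b]|nB] := pselect (outer_betti N p B).
    by exists b.
  by exists 0.
apply: (@ncard_inj_leq _ _ _ _ h).
- by apply: sub_finite_set finite_minimal_nil => b [].
- by move=> B /hP[].
- move=> B B' oB oB' hBB'; have [Bh _ _] := hP _ oB; have [B'h _ _] := hP _ oB'.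
  by apply: outer_betti_disjoint kx hp _ _ _ oB oB' Bh _; rewrite hBB'.
Qed.

(** Each [z] is led to the normal form [t (res z)] by induction on weight: some minimal nil [b]
    below [z] is replaced by [t (res b)]. *)
Lemma spanning_staircase s : [set` s] = [set b | minimal_nil b /\ nonnil p x b] ->
  spanning (factorization_map N p) (fun u => u = None)
    [set` [seq (b, t (res b)) | b <- s]].
Proof.
move=> sE; rewrite /spanning; set G := add_set _ _.
suff key : forall z, nonnil p x z -> eqcl G z (t (res z)).
  move=> a b ab /(factorization_map_nonnil kx hp) na.
  have nb : nonnil p x b.
    by apply/(factorization_map_nonnil kx hp); rewrite -ab; apply/(factorization_map_nonnil kx hp).
  apply: rst_trans (key _ na) _; apply: rst_sym.
  by move: ab => /(factorization_map_eq kx hp na nb) ->; exact: key.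
apply: (finite_set_wf_ind (h := wt) (finite_nonnil hm kx hp)) => z nz IH.
have [/nonnil_t {1}->|nz'] := pselect (nonnil p x' z); first exact: rst_refl.
have [c [b [mb zE]]] := minimal_nil_below nz'.
have [_ nb _] : [/\ nonnil p x c, nonnil p x b & x (res c) + x (res b) = x (res c + res b)].
  by apply/(nonnilD p kx); rewrite -zE.
have rb : res b = res (t (res b)) by rewrite t_residue.
have nt := nonnil_sub (t_nonnil (res b)).
have nz1 : nonnil p x (c + t (res b)) by apply: (nonnil_replace kx _ nt rb); rewrite -zE.
have rz1 : res (c + t (res b)) = res z by rewrite zE (residue_replace c rb).
have := IH _ nz1; rewrite rz1 zE => /(_ (weight_staircase_lt c mb.1)).
apply: rst_trans; apply: rst_step.
(* For [c = 0] the replacement is a listed pair; otherwise both sides share the support of [c]. *)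
have [c0|/eqP c0] := eqVneq c 0.
  right; rewrite c0 !add0r /=; apply: (map_f (fun b => (b, t (res b)))).
  suff : [set` s] b by [].
  by rewrite sE.
left; exists b, (t (res b)), c; split=> //; [exact: addrC|exact: addrC| |].
  by apply/(factorization_map_eq kx hp); rewrite ?rz1 -?zE.
by apply/(factorization_map_nonnil kx hp); rewrite -zE.
Qed.

Lemma ncard_minimal_nil : finite_set (outer_betti N' p) ->
  (ncard minimal_nil <= ncard (outer_betti N' p))%N.
Proof.
move=> fN'; suff [] : finite_set minimal_nil /\
    (ncard minimal_nil <= ncard (outer_betti N' p))%N by [].
apply: (ncard_inj_leq (h := fun b => [set b]) fN'); first exact: minimal_nil_outer_betti.
by move=> b c _ _ bc; have : [set b] b by []; rewrite bc.
Qed.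

End Staircase.

(** The minimal nil vectors of the staircase split into those non-nil for [x], which bound [rho],
    and those nil for [x], which bound the outer Betti elements. *)
Lemma minimal_presentation_bound (R : realType) (m k : nat) (hm : 1 < m)
    (p : k.-tuple (option 'Z_m)) (x x' : 'Z_m -> R) (t : 'Z_m -> expvec k)
    (kx : kunz_point x) (hp : enumerates p (atoms (nilop_of_point x)))
    (kx' : kunz_point x') (hp' : enumerates p (atoms (nilop_of_point x')))
    (nonnil_sub : forall z, nonnil p x' z -> nonnil p x z)
    (t_nonnil : forall q, nonnil p x' (t q)) (t_residue : forall q, residue p (t q) = q)
    (nonnil_t : forall z, nonnil p x' z -> z = t (residue p z))
    (rho : set (expvec k * expvec k)) :
  minimal_presentation (nilop_of_point x) p rho ->
  [/\ finite_set rho, finite_set (outer_betti (nilop_of_point x) p),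
      finite_set (outer_betti (nilop_of_point x') p)
    & ncard rho + ncard (outer_betti (nilop_of_point x) p)
      <= ncard (outer_betti (nilop_of_point x') p)].
Proof.
move=> minrho; have fM := finite_minimal_nil hm kx' hp'.
have fsub (A : set (expvec k)) : A `<=` minimal_nil p x' -> finite_set A.
  by move=> AM; apply: sub_finite_set fM.
have /finite_set_uniq_seq[s [us sE _]] :
  finite_set [set b | minimal_nil p x' b /\ nonnil p x b] by apply: fsub => b [].
have /finite_set_uniq_seq[r [ur rE rN]] :
  finite_set [set b | minimal_nil p x' b /\ ~ nonnil p x b] by apply: fsub => b [].
have [frho le_rho] := inclusion_minimal_leq_spanning (presentationP kx hp) minrho
  (spanning_staircase hm kx hp kx' nonnil_sub t_nonnil t_residue nonnil_t (esym sE)).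
have [fN leN] := ncard_outer_betti_nil hm kx hp kx' hp' nonnil_sub t_nonnil t_residue.
(* The comparison of the staircase with itself gives the finiteness of its outer Betti elements. *)
have [fN' _] := ncard_outer_betti_nil hm kx' hp' kx' hp' (fun z nz => nz) t_nonnil t_residue.
split=> //; apply: leq_trans (ncard_minimal_nil kx' hp' nonnil_t fN').
move: le_rho leN; rewrite size_map rN => le_rho leN.
apply: leq_trans (leq_add le_rho leN) _; rewrite -size_cat.
have sP b : b \in s -> minimal_nil p x' b /\ nonnil p x b.
  by move=> bs; have : [set` s] b by []; rewrite -sE.
have rP b : b \in r -> minimal_nil p x' b /\ ~ nonnil p x b.
  by move=> br; have : [set` r] b by []; rewrite -rE.
apply: seq_leq_ncard => //.
  rewrite cat_uniq us ur andbT; apply/hasPn => b /rP[_ nb].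
  by apply/negP => /sP[].
by move=> b; rewrite /= mem_cat => /orP[/sP[]|/rP[]].
Qed.

(** * Numerical semigroups *)

Lemma lin_morph (V W : nmodType) (h : V -> W) (k : nat) (c : 'I_k -> V) (z : expvec k) :
  (h 0 = 0)%R -> (forall u v, h (u + v) = h u + h v)%R -> h (lin c z) = lin (h \o c) z.
Proof.
move=> h0 hD; elim/expvec_ind: z => [|z i IH]; first by rewrite !lin0.
by rewrite !linD !lin_unit hD IH.
Qed.

Lemma eq_modn_Zp (m : nat) (hm : 1 < m) (n : nat) (q : 'Z_m) :
  n = q %[mod m] <-> (n%:R = q)%R.
Proof.
split=> [e|<-]; first by rewrite -Zp_nat_mod // e Zp_nat_mod // natr_Zp.
by rewrite val_Zp_nat // modn_mod.
Qed.

Lemma finite_set_nat_bounded (A : set nat) : finite_set A ->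
  exists n, forall a, A a -> a < n.
Proof.
move=> /finite_seqP[s ->]; exists (\max_(i <- s) i).+1 => a /= sa.
by rewrite ltnS; apply: leq_bigmax_seq.
Qed.

Definition apery_spec (S : set nat) (m : nat) (w : 'Z_m -> nat) : Prop :=
  forall q, [/\ S (w q), ((w q)%:R = q)%R & forall s, S s -> (s%:R = q)%R -> w q <= s].

(** A cofinite [S] meets every residue class, so the default of [xget] is not taken. *)
Lemma aperyP (S : set nat) (m : nat) : 1 < m -> numerical_semigroup S ->
  apery_spec S (@apery S m).
Proof.
move=> hm [_ /finite_set_nat_bounded[n nP]] q.
have Sge s : n <= s -> S s.
  by move=> ns; apply: contrapT => /nP; rewrite ltnNge ns.
pose P s := `[< S s /\ s = q %[mod m] >].
have exP : exists s, P s.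
  exists (q + n * m); apply/asboolP; split; last by rewrite addnC modnMDl.
  by apply: Sge; rewrite -[leqLHS]muln1; apply: leq_trans (leq_addl _ _); rewrite leq_mul // ltnW.
have [w0 /asboolP[Sw wq] wmin] := ex_minnP exP.
have [Sa aq amin] : [/\ S (apery S q), apery S q = q %[mod m]
    & forall s, S s -> s = q %[mod m] -> apery S q <= s].
  rewrite /apery; set A := [set _ | _]; suff : A (xget 0 A) by [].
  by apply: xgetPex; exists w0; split=> // s Ss sq; apply: wmin; apply/asboolP.
split=> // [|s Ss sq]; first exact/eq_modn_Zp.
by apply: amin => //; apply/eq_modn_Zp.
Qed.

Lemma nilop_of_semigroup_point (R : realType) (S : set nat) (m : nat) :
  nilop_of_semigroup S m = nilop_of_point (fun q : 'Z_m => ((apery S q)%:R : R)%R).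
Proof.
apply: truncated_add_ext => a b; rewrite -natrD.
by split=> [->//|/eqP]; rewrite eqr_nat => /eqP.
Qed.

Section AperyPoint.
Variables (R : realType) (m : nat) (hm : 1 < m) (S : set nat) (w : 'Z_m -> nat).
Hypothesis hS : submonoid S.
Hypothesis wP : apery_spec S w.
Local Notation x := (fun q : 'Z_m => ((w q)%:R : R)%R).

Lemma apery_mem q : S (w q). Proof. by case: (wP q). Qed.

Lemma apery_residue q : ((w q)%:R = q)%R. Proof. by case: (wP q). Qed.

Lemma apery_min s : S s -> w (s%:R)%R <= s.
Proof. by move=> Ss; case: (wP (s%:R)%R) => _ _; apply. Qed.

Lemma apery0 : w 0%R = 0.
Proof. by apply/eqP; rewrite -leqn0 -(mulr0n (1 : 'Z_m)%R) apery_min //; case: hS. Qed.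

Lemma apery_gt0 q : (q != 0)%R -> 0 < w q.
Proof. by rewrite lt0n; apply: contra => /eqP wq; rewrite -[q]apery_residue wq. Qed.

Lemma apery_sub i j : w (i + j)%R <= w i + w j.
Proof.
have -> : (i + j = (w i + w j)%N%:R)%R by rewrite natrD !apery_residue.
by apply: apery_min; case: hS => _; apply; exact: apery_mem.
Qed.

Lemma apery_kunz_point : kunz_point x.
Proof.
split=> [|i i0|i j]; first by rewrite apery0.
- by rewrite ltr0n apery_gt0.
- by rewrite -natrD ler_nat apery_sub.
Qed.

Lemma apery_decomposition s : S s -> exists c, s = w (s%:R)%R + c * m.
Proof.
move=> Ss; have le := apery_min Ss; exists ((s - w (s%:R)%R) %/ m).
have : s = w (s%:R)%R %[mod m].
  have /(eq_modn_Zp hm) -> := erefl (s%:R : 'Z_m)%R.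
  by have /(eq_modn_Zp hm) -> := apery_residue (s%:R)%R.
move=> /eqP; rewrite eqn_mod_dvd // => /divnK ->.
by rewrite subnKC.
Qed.

Variables (k : nat) (p : k.-tuple (option 'Z_m)).
Local Notation a := (atom_residue p).
Local Notation res := (residue p).

Definition apery_weight : expvec k -> nat := lin (w \o a).

(** The number of copies of [m] between the value of [z] and the Apery element of its residue; the
    division is exact by [apery_weightE]. *)
Definition excess z : nat := (apery_weight z - w (res z)) %/ m.

Lemma apery_weightD y z : apery_weight (y + z)%R = apery_weight y + apery_weight z.
Proof. exact: linD. Qed.

Lemma apery_weight_residue z : ((apery_weight z)%:R = res z)%R.
Proof.
rewrite /apery_weight (lin_morph (h := fun n => (n%:R : 'Z_m)%R)) //; last exact: natrD.
by rewrite /residue; congr lin; apply/funext => i /=; rewrite apery_residue.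
Qed.

Lemma weight_apery z : (weight p x z = (apery_weight z)%:R)%R.
Proof.
by rewrite /apery_weight (lin_morph (h := fun n => (n%:R : R)%R)) //; exact: natrD.
Qed.

Lemma nonnil_apery z : nonnil p x z <-> apery_weight z = w (res z).
Proof.
rewrite /nonnil weight_apery; split=> [/eqP|->//].
by rewrite eqr_nat => /eqP.
Qed.

Lemma apery_weight_mem z : S (apery_weight z).
Proof.
have [S0 SD] := hS; elim/expvec_ind: z => [|z i IH].
  by rewrite /apery_weight lin0.
rewrite /apery_weight linD lin_unit; apply: SD IH _; exact: apery_mem.
Qed.

Lemma apery_weightE z : apery_weight z = w (res z) + excess z * m.
Proof.
have [c] := apery_decomposition (apery_weight_mem z).
rewrite apery_weight_residue /excess => ->.
by rewrite addKn mulnK // ltnW.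
Qed.

End AperyPoint.

(** * Factorizations over the generators of a semigroup *)

Section GeneratedSubmonoid.
Variables (e : nat) (g : e.-tuple nat).
Local Notation f := (semigroup_factorization_map g).

Lemma semigroup_factorizationE : f = lin (tnth g).
Proof.
apply/funext => y; rewrite /f /lin; apply: eq_bigr => i _; rewrite mulnC.
by elim: (y i) => [|n IH]; rewrite ?mulr0n ?muln0 // mulrS mulnS IH.
Qed.

Lemma semigroup_factorization0 : f 0%R = 0.
Proof. by rewrite semigroup_factorizationE lin0. Qed.

Lemma semigroup_factorizationD y z : f (y + z)%R = f y + f z.
Proof. by rewrite semigroup_factorizationE linD. Qed.

Lemma semigroup_factorization_unit i : f (unit_vec i) = tnth g i.
Proof. by rewrite semigroup_factorizationE lin_unit. Qed.

Lemma semigroup_factorizationM y n : f (y *+ n)%R = n * f y.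
Proof.
elim: n => [|n IH]; first by rewrite mulr0n semigroup_factorization0.
by rewrite mulrS semigroup_factorizationD IH mulSn.
Qed.

Lemma smallest_submonoidE : smallest submonoid [set` g] = range f.
Proof.
apply/seteqP; split.
  apply: smallest_sub; last first.
    by move=> _ /tnthP[i ->]; exists (unit_vec i) => //; exact: semigroup_factorization_unit.
  split; first by exists 0%R => //; exact: semigroup_factorization0.
  move=> _ _ [y _ <-] [z _ <-]; exists (y + z)%R => //.
  exact: semigroup_factorizationD.
move=> _ [y _ <-] M [[M0 MD] gM]; elim/expvec_ind: y => [|y i IH].
  by rewrite semigroup_factorization0.
rewrite semigroup_factorizationD semigroup_factorization_unit; apply: MD IH _.
by apply: gM; rewrite /= mem_tnth.
Qed.

End GeneratedSubmonoid.

Definition embed (k e : nat) (gen : 'I_k -> 'I_e) : expvec k -> expvec e :=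
  lin (fun j => unit_vec (gen j)).

Lemma embedD k e (gen : 'I_k -> 'I_e) y z :
  embed gen (y + z)%R = (embed gen y + embed gen z)%R.
Proof. exact: linD. Qed.

Lemma embed_coord k e (gen : 'I_k -> 'I_e) z j : injective gen -> embed gen z (gen j) = z j.
Proof.
move=> gen_inj; rewrite /embed; elim/expvec_ind: z => [|z i IH].
  by rewrite lin0 !expvec0.
by rewrite linD lin_unit !expvecD IH !ffunE (inj_eq gen_inj).
Qed.

Lemma embed_inj k e (gen : 'I_k -> 'I_e) : injective gen -> injective (embed gen).
Proof.
move=> gen_inj y z /ffunP yz; apply/ffunP => j.
by have := yz (gen j); rewrite !embed_coord.
Qed.

Lemma embed_support k e (gen : 'I_k -> 'I_e) z i : 0 < embed gen z i -> exists j, i = gen j.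
Proof.
rewrite /embed; elim/expvec_ind: z => [|z j IH]; first by rewrite lin0 expvec0.
rewrite linD lin_unit expvecD ffunE; case: eqP => [-> _|_]; first by exists j.
by rewrite addn0.
Qed.

Lemma semigroup_factorization_embed m k (p : k.-tuple (option 'Z_m)) (w : 'Z_m -> nat)
    e (g : e.-tuple nat) (gen : 'I_k -> 'I_e) z :
  (forall j, tnth g (gen j) = w (atom_residue p j)) ->
  semigroup_factorization_map g (embed gen z) = apery_weight w p z.
Proof.
move=> genE; rewrite /embed /apery_weight; elim/expvec_ind: z => [|z i IH].
  by rewrite !lin0 semigroup_factorization0.
by rewrite !linD !lin_unit semigroup_factorizationD IH semigroup_factorization_unit genE.
Qed.

(* [mu] expresses [m] in the generators [g]: it is a unit vector when [m] is a
   generator, and a factorization of [m] through the atoms otherwise. *)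
Record generator_embedding (R : realType) (m k : nat) (p : k.-tuple (option 'Z_m))
    (w : 'Z_m -> nat) (x' : 'Z_m -> R) (e : nat) (g : e.-tuple nat)
    (gen : 'I_k -> 'I_e) (mu : expvec e) : Prop := GeneratorEmbedding {
  generator_inj : injective gen;
  generator_value : forall j, tnth g (gen j) = w (atom_residue p j);
  generator_gt0 : forall i, 0 < tnth g i;
  multiplicity_value : semigroup_factorization_map g mu = m;
  embed_decomposition : forall y, exists z c, y = (embed gen z + mu *+ c)%R;
  multiplicity_minimal : forall b y, minimal_nil p x' b -> embed gen b <> mu ->
    embed gen b <> (y + mu)%R }.

(** * Relations of a semigroup indexed by minimal nil vectors *)

Section SemigroupPresentations.
Variables (R : realType) (m k : nat) (hm : 1 < m) (p : k.-tuple (option 'Z_m)).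
Variables (S : set nat) (w : 'Z_m -> nat).
Hypothesis hS : submonoid S.
Hypothesis wP : apery_spec S w.
Let x : 'Z_m -> R := fun q => ((w q)%:R)%R.
Hypothesis hp : enumerates p (atoms (nilop_of_point x)).
Variable x' : 'Z_m -> R.
Hypothesis kx' : kunz_point x'.
Hypothesis hp' : enumerates p (atoms (nilop_of_point x')).
Hypothesis nonnil_sub : forall z, nonnil p x' z -> nonnil p x z.
Variable t : 'Z_m -> expvec k.
Hypothesis t_nonnil : forall q, nonnil p x' (t q).
Hypothesis t_residue : forall q, residue p (t q) = q.
Hypothesis nonnil_t : forall z, nonnil p x' z -> z = t (residue p z).
Variables (e : nat) (g : e.-tuple nat) (gen : 'I_k -> 'I_e) (mu : expvec e).
Hypothesis gmu : generator_embedding p w x' g gen mu.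
Local Notation a := (atom_residue p).
Local Notation res := (residue p).
Local Notation f := (semigroup_factorization_map g).
Local Notation aw := (apery_weight w p).
Local Notation exc := (excess w p).
Local Notation emb := (embed gen).
Local Notation no_nil := (fun _ : nat => False).
Implicit Types (b c z : expvec k).

Let kx : kunz_point x := apery_kunz_point R hS wP.
Let aw_nonnil z : nonnil p x z <-> aw z = w (res z) := nonnil_apery R w p z.
Let awE z : aw z = w (res z) + exc z * m := apery_weightE hm hS wP p z.

Definition semigroup_relation b : expvec e * expvec e :=
  (emb b, (emb (t (res b)) + mu *+ exc b)%R).

Let factorization_embed z : f (emb z) = aw z :=
  semigroup_factorization_embed z (generator_value gmu).

Lemma factorization_mu n : f (mu *+ n)%R = n * m.
Proof. by rewrite semigroup_factorizationM (multiplicity_value gmu). Qed.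

Lemma apery_weight_t q : aw (t q) = w q.
Proof. by rewrite -{2}(t_residue q); apply/aw_nonnil/nonnil_sub. Qed.

Lemma excess_eq0 z : aw z = w (res z) -> exc z = 0.
Proof. by rewrite /excess => ->; rewrite subnn div0n. Qed.

(** The two sums have the same residue, so their excesses differ as their values do, and [t (res b)]
    has the value [w (res b)]. *)
Lemma excess_replace c b : exc (c + b)%R = exc b + exc (c + t (res b))%R.
Proof.
have rE : res (c + b)%R = res (c + t (res b))%R.
  by apply: residue_replace; rewrite t_residue.
apply/eqP; rewrite -(eqn_pmul2r (ltnW hm)) mulnDl -(eqn_add2l (w (res (c + b)%R))).
rewrite -awE rE addnCA -awE !apery_weightD apery_weight_t (awE b).
by apply/eqP; lia.
Qed.

Lemma factorization_relation b : f (semigroup_relation b).1 = f (semigroup_relation b).2.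
Proof.
by rewrite /= semigroup_factorizationD !factorization_embed factorization_mu
  apery_weight_t -awE.
Qed.

Lemma semigroup_factorization_lt (y z : expvec e) : z <> 0%R -> f y < f (y + z)%R.
Proof.
move=> /expvec_neq0P[i /expvec_posP[u ->]].
rewrite !semigroup_factorizationD semigroup_factorization_unit.
by have := generator_gt0 gmu i; lia.
Qed.

(** Nothing is nil here, and the value itself is a rank because all generators are positive. *)
Lemma semigroup_presentationP sigma : generating_set (kernel f) sigma <->
  sigma `<=` nonnil_kernel f no_nil /\ spanning f no_nil sigma.
Proof.
have fD (b c d : expvec e) : f b = f c -> f (b + d)%R = f (c + d)%R.
  by rewrite !semigroup_factorizationD => ->.
have fC (b c d : expvec e) : ~ no_nil (f (b + d)%R) ->
    f (b + d)%R = f (c + d)%R -> f b = f c.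
  by move=> _; rewrite !semigroup_factorizationD => /addIn.
have fR (b d : expvec e) : ~ no_nil (f (b + d)%R) -> d <> 0%R ->
    id (f b) < id (f (b + d)%R).
  by move=> _; exact: semigroup_factorization_lt.
split=> [gen_s|[sK span]].
  split=> [[y z] yz|].
    by split=> //; have : kernel f (y, z) by rewrite -gen_s => C [_]; apply.
  have := generating_set_spanning (nil := no_nil) fD gen_s.
  congr (spanning _ _ _); apply/seteqP; split=> [?[]//|? ?]; by split.
have := spanning_generating_set (nil := no_nil) (rank := id) fD fC fR sK span.
by congr (generating_set _ _); apply/seteqP; split=> [?[//|[]//]|? ?]; left.
Qed.

Lemma apery_weight_bound z j : z j <= aw z.
Proof.
rewrite /apery_weight /lin (bigD1 j) //=.
apply: leq_trans (leq_addr _ _).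
have : 0 < w (a j) by apply: apery_gt0 wP _ _; exact: atom_residue_neq0 hp j.
rewrite /=; elim: (z j) => // n IH w0.
by rewrite mulrS; have := IH w0; lia.
Qed.

Lemma finite_apery_weight n : finite_set [set z | aw z <= n].
Proof.
apply: sub_finite_set (finite_expvec k n) => z /= zn j.
exact: leq_trans (apery_weight_bound z j) zn.
Qed.

(** For [r <> 0] the two ends share the summand [r]; for [r = 0] they form the relation of [b]. If
    [emb b = mu], then [b] has value [m], residue 0 and excess 1, and the two ends are equal. *)
Lemma relation_step (G : expvec e -> expvec e -> Prop) b (r : expvec e) :
  (forall u v, shared_support f no_nil u v -> G u v) ->
  (emb b <> mu -> G (semigroup_relation b).1 (semigroup_relation b).2) ->
  eqcl G (emb b + r)%R (emb (t (res b)) + mu *+ exc b + r)%R.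
Proof.
move=> Gsh Gb; have [bmu|/eqP bmu] := eqVneq (emb b) mu.
  have awm : aw b = m by rewrite -factorization_embed bmu (multiplicity_value gmu).
  have rb : res b = 0%R.
    by rewrite -(apery_weight_residue wP) awm; apply/(eq_modn_Zp hm); rewrite modnn mod0n.
  have t0 : t 0%R = 0%R.
    apply: contrapT => /(residue_neq0 kx' hp' (t_nonnil 0%R)).
    by rewrite t_residue eqxx.
  have -> : exc b = 1.
    have := awE b; rewrite awm rb (apery0 hS wP) add0n => mE.
    by apply/eqP; rewrite -(eqn_pmul2r (ltnW hm)) mul1n -mE.
  by rewrite rb t0 /embed lin0 add0r mulr1n -/emb bmu; exact: rst_refl.
have [->|/eqP r0] := eqVneq r 0%R.
  by rewrite !addr0; apply: rst_step; exact: Gb.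
apply/rst_step/Gsh; exists (emb b), (emb (t (res b)) + mu *+ exc b)%R, r; split=> //.
by rewrite 2!semigroup_factorizationD (factorization_relation b).
Qed.

(** As for nilsemigroups, with copies of [mu] added to the normal form, which the value of a vector
    determines. *)
Lemma spanning_semigroup s :
  [set` s] = [set b | minimal_nil p x' b /\ emb b <> mu] ->
  spanning f no_nil [set` [seq semigroup_relation b | b <- s]].
Proof.
move=> sE; rewrite /spanning; set G := add_set _ _.
(* The bound [n] confines the descent in weight to a finite set; replacing [b] by [t (res b)] never
   raises [aw]. *)
suff key n : forall z, aw z <= n -> forall c : nat,
    eqcl G (emb z + mu *+ c)%R (emb (t (res z)) + mu *+ (exc z + c))%R.
  move=> y y' yy' _.
  have [z [c yE]] := embed_decomposition gmu y.
  have [z' [c' yE']] := embed_decomposition gmu y'.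
  move: yy'; rewrite yE yE' !semigroup_factorizationD !factorization_embed !factorization_mu.
  move=> fE; have rE : res z = res z'.
    have mod0 d : ((d * m)%N%:R = 0 :> 'Z_m)%R.
      by apply/(eq_modn_Zp hm); rewrite modnMl mod0n.
    have := congr1 (fun n => n%:R : 'Z_m)%R fE.
    by rewrite !natrD !mod0 !addr0 !(apery_weight_residue wP).
  have cE : exc z + c = exc z' + c'.
    apply/eqP; rewrite -(eqn_pmul2r (ltnW hm)) !mulnDl; apply/eqP.
    by move: fE; rewrite awE (awE z') rE; lia.
  apply: rst_trans (key _ z (leqnn _) c) _; rewrite rE cE; apply: rst_sym.
  exact: key (leqnn _) _.
apply: (finite_set_wf_ind (h := weight p x') (finite_apery_weight n)) => z /= zn IH c.
have [nz|nz] := pselect (nonnil p x' z).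
  rewrite excess_eq0; last exact/aw_nonnil/nonnil_sub.
  by rewrite -(nonnil_t nz); exact: rst_refl.
have [d [b [mb zE]]] := minimal_nil_below nz.
have rb : res z = res (d + t (res b))%R.
  by rewrite zE; apply: residue_replace; rewrite t_residue.
have lt : (weight p x' (d + t (res b)) < weight p x' z)%R.
  by rewrite zE; apply: (weight_staircase_lt kx' t_nonnil t_residue); case: mb.
have le : aw (d + t (res b))%R <= n.
  apply: leq_trans zn; rewrite zE !apery_weightD leq_add2l apery_weight_t.
  by rewrite awE leq_addr.
have zc : exc z + c = exc (d + t (res b))%R + (exc b + c).
  by rewrite zE excess_replace; lia.
have := IH _ le lt (exc b + c); rewrite -rb -zc; apply: rst_trans.
have -> : (emb z + mu *+ c = emb b + (emb d + mu *+ c))%R.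
  by rewrite zE embedD addrCA addrA.
have -> : (emb (d + t (res b)) + mu *+ (exc b + c) =
    emb (t (res b)) + mu *+ exc b + (emb d + mu *+ c))%R.
  by rewrite embedD mulrnDr [in LHS](addrC (emb d)) addrACA.
apply: relation_step => [u v uv|bmu]; first by left.
right; apply: (map_f semigroup_relation).
suff : [set` s] b by [].
by rewrite sE.
Qed.

Lemma semigroup_minimal_presentation_leq s sigma :
  [set` s] = [set b | minimal_nil p x' b /\ emb b <> mu] ->
  semigroup_minimal_presentation g sigma ->
  finite_set sigma /\ ncard sigma <= size s.
Proof.
move=> sE mins; rewrite -(size_map semigroup_relation).
apply: (inclusion_minimal_leq_spanning (nil := no_nil) semigroup_presentationP mins).
exact: spanning_semigroup.
Qed.

(** Here [x] and [x'] have the same non-nil vectors. The shared generator is some [gen j], and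
    removing it from [b] leaves a non-nil [d], whose value is an Apery element. Any factorization of
    that value decomposes without [mu] into a non-nil vector, which is [d] by uniqueness. *)
Lemma embed_isolated b (y y' : expvec e) :
  (forall z, nonnil p x z -> nonnil p x' z) -> minimal_nil p x' b ->
  shared_support f no_nil y y' -> y = emb b -> y' = emb b.
Proof.
move=> nonnil_sub' [_ mb] [u [v [r [-> -> r0 fE _]]]] uE.
have [i /expvec_posP[r' rE]] := expvec_neq0P r0.
have bi : 0 < emb b i.
  by rewrite -uE rE addrA expvecD [unit_vec i i]ffunE eqxx addn1.
have [j ij] := embed_support bi.
have /expvec_posP[d bE] : 0 < b j.
  by rewrite -(embed_coord b j (generator_inj gmu)) -ij.
have unitE : unit_vec i = emb (unit_vec j) by rewrite /embed lin_unit ij.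
move: fE uE; rewrite rE bE embedD -unitE !addrA => fE /expvec_addIr uE.
have nd := mb _ _ bE; congr (_ + _)%R.
move: fE; rewrite uE 2!semigroup_factorizationD => /addIn.
rewrite factorization_embed ((aw_nonnil d).1 (nonnil_sub nd)) => fE.
have [z [c vE]] := embed_decomposition gmu (v + r')%R.
move: fE; rewrite vE semigroup_factorizationD factorization_embed factorization_mu => fE.
have rdz : res d = res z.
  rewrite -(apery_weight_residue wP p z) -[LHS](apery_residue wP) fE natrD.
  rewrite [(c * m)%:R%R](_ : _ = 0%R) ?addr0 //.
  by apply/(eq_modn_Zp hm); rewrite modnMl mod0n.
have [c0 ec0] : c = 0 /\ exc z = 0.
  by move: fE; rewrite awE rdz; have := ltnW hm; nia.
have nz : nonnil p x' z by apply/nonnil_sub'/aw_nonnil; rewrite awE ec0 addn0.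
by rewrite c0 mulr0n addr0 (nonnil_t nz) -rdz -nonnil_t.
Qed.

(** For [c = 0] the vector [t q] is non-nil while [b] is not; for [c > 0] the vector [emb b] would
    contain [mu]. *)
Lemma relation_target_neq b q (c : nat) : minimal_nil p x' b -> emb b <> mu ->
  (emb (t q) + mu *+ c <> emb b)%R.
Proof.
move=> mb bmu; case: c => [|c].
  rewrite mulr0n addr0 => /(embed_inj (generator_inj gmu)) tb.
  by case: mb => nb _; apply: nb; rewrite -tb.
rewrite mulrSr addrA => /esym; exact: (multiplicity_minimal gmu mb bmu).
Qed.

(** Without its own relation, [emb b] is an isolated vertex: shared supports do not lead away from
    it, and other relations neither start nor end there. *)
Lemma independent_semigroup s : (forall z, nonnil p x z -> nonnil p x' z) -> uniq s ->
  (forall b, b \in s -> minimal_nil p x' b /\ emb b <> mu) ->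
  independent (shared_support f no_nil) [seq semigroup_relation b | b <- s].
Proof.
move=> nonnil_sub' us sP.
have rel_inj : injective semigroup_relation.
  by move=> b c [/(embed_inj (generator_inj gmu))].
apply: independentP; first by rewrite map_inj_uniq.
move=> _ /mapP[b /sP[mb bmu] ->]; set G := add_set _ _.
have sym u v : shared_support f no_nil u v -> shared_support f no_nil v u.
  by move=> [u' [v' [r [-> -> r0 fE nn]]]]; exists v', u', r; rewrite -fE.
suff iso u v : eqcl G u v -> u = emb b <-> v = emb b.
  by move=> /iso[/(_ erefl) /(relation_target_neq mb bmu)].
elim=> {u v} [u v [uv|[/mapP[c cs [-> ->]] ne]]|u|u v _ ->|u v r _ -> _ ->] //.
- split; first exact: (embed_isolated nonnil_sub' mb uv).
  exact: (embed_isolated nonnil_sub' mb (sym _ _ uv)).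
- split=> [/(embed_inj (generator_inj gmu)) cb|/(relation_target_neq mb bmu)//].
  by case: ne; rewrite cb.
Qed.

Lemma semigroup_minimal_presentation_geq s sigma :
  (forall z, nonnil p x z -> nonnil p x' z) -> uniq s ->
  (forall b, b \in s -> minimal_nil p x' b /\ emb b <> mu) ->
  finite_set sigma -> semigroup_minimal_presentation g sigma -> size s <= ncard sigma.
Proof.
move=> nonnil_sub' us sP fs [/semigroup_presentationP[_ span] _].
rewrite -(size_map semigroup_relation).
apply: independent_leq_ncard (independent_semigroup nonnil_sub' us sP) _ span fs.
move=> _ /= /mapP[b _ ->]; split=> //; exact: factorization_relation.
Qed.

End SemigroupPresentations.

Lemma expvecM k (a : expvec k) n i : (a *+ n)%R i = n * a i.
Proof. by elim: n => [|n IH]; rewrite ?expvec0 // mulrS expvecD IH mulSn. Qed.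

Lemma semigroup_factorization_gt0 e (g : e.-tuple nat) y :
  0 < semigroup_factorization_map g y ->
  exists z i, y = (z + unit_vec i)%R /\ 0 < tnth g i.
Proof.
elim/expvec_ind: y => [|y i IH]; first by rewrite semigroup_factorization0.
rewrite semigroup_factorizationD semigroup_factorization_unit.
have [gi _|gi] := ltnP 0 (tnth g i); first by exists y, i.
rewrite addn_gt0 (leqNgt _ 0) in gi *; rewrite (negbTE gi) orbF => /IH[z [j [-> gj]]].
by exists (z + unit_vec i)%R, j; rewrite addrAC.
Qed.

(** * Minimal generators of a numerical semigroup *)

Section MinimalGenerators.
Variables (R : realType) (m k : nat) (hm : 1 < m) (p : k.-tuple (option 'Z_m)).
Variables (S : set nat) (w : 'Z_m -> nat).
Hypothesis hS : submonoid S.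
Hypothesis Sm : S m.
Hypothesis wP : apery_spec S w.
Let x : 'Z_m -> R := fun q => ((w q)%:R)%R.
Hypothesis hp : enumerates p (atoms (nilop_of_point x)).
Variables (e : nat) (g : e.-tuple nat).
Hypothesis ming : minimal_generators S [set` g].
Hypothesis ug : uniq g.
Local Notation a := (atom_residue p).
Local Notation res := (residue p).
Local Notation f := (semigroup_factorization_map g).
Local Notation aw := (apery_weight w p).

Let kx : kunz_point x := apery_kunz_point R hS wP.
Let SE : S = range f.
Proof. by case: ming => <- _; exact: smallest_submonoidE. Qed.

Lemma generator_mem i : S (tnth g i).
Proof. by rewrite SE; exists (unit_vec i) => //; exact: semigroup_factorization_unit. Qed.

Lemma m_residue c : ((c * m)%:R = 0 :> 'Z_m)%R.
Proof. by apply/(eq_modn_Zp hm); rewrite modnMl mod0n. Qed.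

(** Both summands are Apery elements, as a spare [m] would contradict subadditivity of [w]; a proper
    splitting would then split the atom in the nilsemigroup. *)
Lemma apery_atom_irreducible j s1 s2 : S s1 -> S s2 -> s1 + s2 = w (a j) ->
  s1 = 0 \/ s2 = 0.
Proof.
move=> S1 S2; have [c1 s1E] := apery_decomposition hm wP S1.
have [c2 s2E] := apery_decomposition hm wP S2.
set q1 : 'Z_m := (s1%:R)%R in s1E; set q2 : 'Z_m := (s2%:R)%R in s2E => sE.
have qE : (q1 + q2 = a j)%R by rewrite -natrD sE (apery_residue wP).
have le := apery_sub hS wP q1 q2.
have [c10 c20] : c1 = 0 /\ c2 = 0.
  by move: sE le; rewrite s1E s2E qE; have := ltnW hm; nia.
move: s1E s2E; rewrite c10 c20 !addn0 => s1E s2E.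
have [q10|q10] := eqVneq q1 0%R; first by left; rewrite s1E q10 (apery0 hS wP).
have [q20|q20] := eqVneq q2 0%R; first by right; rewrite s2E q20 (apery0 hS wP).
case: (atom_residue_irreducible hp q10 q20 qE).
by rewrite /x -natrD -s1E -s2E sE qE.
Qed.

Lemma apery_atom_generator j : exists i, tnth g i = w (a j).
Proof.
have : S (w (a j)) by exact: apery_mem wP _.
rewrite {1}SE => -[y _ fy].
have [] := @semigroup_factorization_gt0 _ g y.
  by rewrite fy (apery_gt0 wP) // (atom_residue_neq0 hp).
move=> z [i [yE gi]]; exists i.
have Sz : S (f z) by rewrite SE; exists z.
move: fy; rewrite yE semigroup_factorizationD semigroup_factorization_unit => fy.
case: (apery_atom_irreducible Sz (generator_mem i) fy) => [z0|i0].
  by rewrite -fy z0.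
by rewrite i0 in gi.
Qed.

(** By minimality of [g] it is enough that its members of these two kinds generate [S]. Every Apery
    element is a sum of those at the atoms. *)
Lemma generator_cases i : tnth g i = m \/ exists j, tnth g i = w (a j).
Proof.
pose B := [set s | s \in g /\ (s = m \/ exists j, s = w (a j))].
suff BE : B = [set` g].
  have : [set` g] (tnth g i) by exact: mem_tnth.
  by rewrite -BE => -[_].
case: ming => _; apply; last by move=> s [].
apply/seteqP; split.
  apply: smallest_sub hS _ => s [/tnthP[l ->] _]; exact: generator_mem.
move=> s Ss M [[M0 MD] BM].
have Mw q : M (w q).
  have [z nz <-] := nonnil_exists kx hp q.
  rewrite -((nonnil_apery R w p z).1 nz); elim/expvec_ind: {q nz}z => [|z j IH].
    by rewrite /apery_weight lin0.
  rewrite apery_weightD; apply: MD IH _; rewrite /apery_weight lin_unit -[_ j]/(w (a j)).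
  apply: BM; split; last by right; exists j.
  by have [l <-] := apery_atom_generator j; exact: mem_tnth.
(* If [m] is not a generator, the generators occurring in it are smaller than [m], hence Apery
   elements. *)
have Mm : M m.
  have [mg|mg] := boolP (m \in g); first by apply: BM; split=> //; left.
  have := Sm; rewrite {1}SE => -[y _ fy].
  suff le z : f z <= m -> M (f z) by rewrite -fy; apply: le; rewrite fy.
  elim/expvec_ind: z => [|z l IH]; first by rewrite semigroup_factorization0.
  rewrite semigroup_factorizationD semigroup_factorization_unit => le.
  apply: MD; first by apply: IH; apply: leq_trans le; exact: leq_addr.
  have gm : tnth g l < m.
    rewrite ltn_neqAle (leq_trans (leq_addl _ _) le) andbT.
    by apply: contraNneq mg => <-; exact: mem_tnth.
  have [c cE] := apery_decomposition hm wP (generator_mem l).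
  have c0 : c = 0 by move: gm; rewrite cE; nia.
  by rewrite cE c0 addn0.
have [c ->] := apery_decomposition hm wP Ss.
by apply: (MD _ _ (Mw _)); elim: c => // c IH; rewrite mulSn; exact: MD.
Qed.

Lemma generator_positive i : 0 < tnth g i.
Proof.
case: (generator_cases i) => [->|[j ->]]; first exact: ltnW.
by rewrite (apery_gt0 wP) // (atom_residue_neq0 hp).
Qed.

Lemma apery_atom_neq_m j : w (a j) <> m.
Proof.
move=> wm; have := atom_residue_neq0 hp j.
by rewrite -(apery_residue wP (a j)) wm; have := m_residue 1; rewrite mul1n => ->; rewrite eqxx.
Qed.

Section Embedding.
Variable x' : 'Z_m -> R.
Hypothesis kx' : kunz_point x'.
Hypothesis hp' : enumerates p (atoms (nilop_of_point x')).
Hypothesis nonnil_sub : forall z, nonnil p x' z -> nonnil p x z.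
Variable t : 'Z_m -> expvec k.
Hypothesis t_nonnil : forall q, nonnil p x' (t q).
Hypothesis t_residue : forall q, residue p (t q) = q.
Hypothesis nonnil_t : forall z, nonnil p x' z -> z = t (residue p z).
Variable gen : 'I_k -> 'I_e.
Hypothesis genE : forall j, tnth g (gen j) = w (a j).
Local Notation emb := (embed gen).

Let gen_inj : injective gen.
Proof.
move=> i j ij; apply: (atom_residue_inj hp).
by rewrite -(apery_residue wP (a i)) -genE ij genE (apery_residue wP).
Qed.

Let gen_cases i : tnth g i = m \/ exists j, i = gen j.
Proof.
case: (generator_cases i) => [|[j gj]]; [by left|right; exists j].
by move/tuple_uniqP: ug; apply; rewrite gj genE.
Qed.

(** The generator [m] is outside the image of [gen], because Apery elements at atoms have nonzero
    residue. *)
Lemma generator_embedding_unit i0 : tnth g i0 = m ->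
  generator_embedding p w x' g gen (unit_vec i0) /\ forall b, emb b <> unit_vec i0.
Proof.
move=> gi0; have gen_i0 j : i0 <> gen j.
  by move=> ij; apply: (@apery_atom_neq_m j); rewrite -genE -ij.
have emb_i0 b : emb b i0 = 0.
  apply/eqP; rewrite -leqn0 leqNgt; apply/negP => /embed_support[j].
  exact: gen_i0.
have emb_neq b y : emb b <> (y + unit_vec i0)%R.
  move=> /ffunP /(_ i0); rewrite emb_i0 expvecD [unit_vec i0 i0]ffunE eqxx.
  by rewrite addn1.
split=> [|b be]; last by apply: (emb_neq b 0%R); rewrite add0r.
split=> //; [exact: generator_positive|by rewrite semigroup_factorization_unit|].
move=> y; exists [ffun j => y (gen j)], (y i0); apply/ffunP => i.
rewrite expvecD expvecM; have [->|[j ->]] : i = i0 \/ exists j, i = gen j.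
- case: (gen_cases i) => [gi|]; [left|by right].
  by move/tuple_uniqP: ug; apply; rewrite gi.
- by rewrite emb_i0 [unit_vec i0 i0]ffunE eqxx muln1.
- rewrite embed_coord // !ffunE; case: eqP => [/esym/gen_i0//|_].
  by rewrite muln0 addn0.
Qed.

(** All generators now come from atoms. Among the factorizations of [m], one of least weight for
    [x'] is a minimal nil vector and serves as [mu]. *)
Lemma generator_embedding_atoms : m \notin g -> exists mu u,
  [/\ generator_embedding p w x' g gen mu, minimal_nil p x' u & emb u = mu].
Proof.
move=> mg; have gen_surj i : exists j, i = gen j.
  case: (gen_cases i) => // gi.
  by case/negP: mg; rewrite -gi; exact: mem_tnth.
have emb_surj y : exists z, y = emb z.
  exists [ffun j => y (gen j)]; apply/ffunP => i; have [j ->] := gen_surj i.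
  by rewrite embed_coord // ffunE.
pose A := [set z | aw z = m].
have fA : finite_set A.
  apply: sub_finite_set (finite_apery_weight hm wP hp m) => z Az /=.
  by rewrite Az.
have A0 : A !=set0.
  have := Sm; rewrite {1}SE => -[y _ fy]; have [z yE] := emb_surj y.
  by exists z; rewrite /A /= -(semigroup_factorization_embed z genE) -yE.
have [u Au umin] := finite_set_min (weight p x') fA A0.
have nu : ~ nonnil p x' u.
  move=> nu; have := Au; rewrite /A /=.
  have /nonnil_apery -> := nonnil_sub nu.
  rewrite -(apery_weight_residue wP) Au.
  have := m_residue 1; rewrite mul1n => ->; rewrite (apery0 hS wP) => m0.
  by move: hm; rewrite -m0.
have aw_t q : aw (t q) = w q.
  by rewrite -{2}(t_residue q); apply/(nonnil_apery R)/nonnil_sub.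
have mu : minimal_nil p x' u.
  have [d [b [mb uE]]] := minimal_nil_below nu.
  have /eqP := Au; rewrite uE apery_weightD (apery_weightE hm hS wP p b).
  (* If [b] has positive excess, its value is already at least [m], so [d = 0]. If its excess is 0,
     replacing it by [t (res b)] keeps the value [m] and lowers the weight. *)
  case ec: (excess w p b) => [|c] /eqP awu; last first.
    have d0 : aw d = 0 by move: awu; rewrite mulSn; nia.
    have [->|/eqP/expvec_neq0P[j]] := eqVneq d 0%R; first by rewrite add0r.
    by rewrite ltnNge (leq_trans (apery_weight_bound hm wP hp d j)) // d0.
  have At : A (d + t (residue p b))%R.
    by rewrite /A /= apery_weightD aw_t; move: awu; rewrite mul0n addn0.
  have := umin _ At; rewrite uE leNgt (weight_staircase_lt kx' t_nonnil t_residue) //.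
  by case: mb.
exists (emb u), u; split=> //; split=> //.
- exact: generator_positive.
- by rewrite (semigroup_factorization_embed u genE).
- by move=> y; have [z ->] := emb_surj y; exists z, 0; rewrite mulr0n addr0.
(* A minimal nil [b] cannot properly contain the nil vector [u]. *)
- move=> b y mb bu; have [d ->] := emb_surj y.
  rewrite -embedD => /(embed_inj gen_inj) bE; apply: bu.
  have [d0|/eqP/expvec_neq0P[j /expvec_posP[c dE]]] := eqVneq d 0%R.
    by rewrite bE d0 add0r.
  case: mb => _ /(_ (c + u)%R j); rewrite bE dE addrAC => /(_ erefl).
  by move=> /(nonnilD p kx')[_ /nu].
Qed.

End Embedding.

(** The relation of one minimal nil vector, the one that embeds to [mu], drops out exactly when [m]
    is not a generator. *)
Lemma exists_generator_embedding (x' : 'Z_m -> R) (t : 'Z_m -> expvec k) s :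
  kunz_point x' -> (forall z, nonnil p x' z -> nonnil p x z) ->
  (forall q, nonnil p x' (t q)) -> (forall q, residue p (t q) = q) ->
  uniq s -> [set` s] = minimal_nil p x' ->
  exists gen mu, generator_embedding p w x' g gen mu /\
    size [seq b <- s | embed gen b != mu] + (m \notin g) = size s.
Proof.
move=> kx' nonnil_sub t_nonnil t_residue us sE.
have /choice[gen genE] := apery_atom_generator.
have [/tnthP[i0 gi0]|mg] := boolP (m \in g).
  have [gmu neq] := generator_embedding_unit x' genE (esym gi0).
  exists gen, (unit_vec i0); split=> //; rewrite addn0.
  by congr size; apply/all_filterP/allP => b _; apply/eqP.
have [mu [u [gmu mu_u umu]]] :=
  generator_embedding_atoms kx' nonnil_sub t_nonnil t_residue genE mg.
exists gen, mu; split=> //.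
have us' : u \in s by suff : [set` s] u by []; rewrite sE.
have -> : [seq b <- s | embed gen b != mu] = rem u s.
  rewrite rem_filter //; apply: eq_filter => b /=.
  by rewrite -umu (inj_eq (embed_inj (generator_inj gmu))).
rewrite size_rem // addn1 prednK //.
by case: (s) us'.
Qed.

End MinimalGenerators.

(** * Staircase refinements and the comparison of two semigroups *)

Section Refinement.
Variables (R : realType) (m k : nat) (p : k.-tuple (option 'Z_m)).
Variable x : 'Z_m -> R.
Hypothesis kx : kunz_point x.
Hypothesis hp : enumerates p (atoms (nilop_of_point x)).

Lemma staircase_section : staircase (nilop_of_point x) p ->
  exists t : 'Z_m -> expvec k, [/\ forall q, nonnil p x (t q),
    forall q, residue p (t q) = q & forall z, nonnil p x z -> z = t (residue p z)].
Proof.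
move=> st; have /choice[t tP] q : exists z, nonnil p x z /\ residue p z = q.
  by have [z] := nonnil_exists kx hp q; exists z.
exists t; split=> [q|q|z nz]; [by case: (tP q)|by case: (tP q)|].
have [z0 [_ z0_uniq]] := st (residue p z).
have [tn tr] := tP (residue p z).
by apply: etrans (esym (z0_uniq z _)) (z0_uniq _ _); exact/(factorizations_Some kx hp).
Qed.

Lemma refinement_nonnil (x' : 'Z_m -> R) : kunz_point x' ->
  refinement (nilop_of_point x) (nilop_of_point x') p ->
  enumerates p (atoms (nilop_of_point x')) /\
  forall z, nonnil p x' z -> nonnil p x z.
Proof.
move=> kx' [atomsE sub].
have hp' : enumerates p (atoms (nilop_of_point x')) by rewrite -atomsE.
split=> // z nz; have : factorizations (nilop_of_point x') p (Some (residue p z)) z.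
  exact/(factorizations_Some kx' hp').
by move=> /sub /(factorizations_Some kx hp)[].
Qed.

Lemma exists_staircase_refinement : 1 < m -> exists N' : nilop m,
  [/\ kunz_nilsemigroup R N', staircase N' p & refinement (nilop_of_point x) N' p].
Proof.
move=> hm; have [x' [kx' atomsE sub stair]] := exists_staircase hm kx hp.
have hp' : enumerates p (atoms (nilop_of_point x')) by rewrite -atomsE.
exists (nilop_of_point x'); split.
- exact: point_kunz_nilsemigroup.
- move=> q; have [z nz zq] := nonnil_exists kx' hp' q; exists z.
  split=> [|z' /(factorizations_Some kx' hp')[nz' z'q]].
    exact/(factorizations_Some kx' hp').
  by apply: stair; rewrite ?zq.
- split=> // q z /(factorizations_Some kx' hp')[/sub nz zq].
  exact/(factorizations_Some kx hp).
Qed.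

End Refinement.

(** Both semigroups have relations indexed by the minimal nil vectors of the staircase: these
    relations span for [S] and are independent for [S']. *)
Lemma semigroup_minimal_presentation_mono (R : realType) (m k : nat) (hm : 1 < m)
    (p : k.-tuple (option 'Z_m)) (S S' : set nat) :
  enumerates p (atoms (nilop_of_semigroup S m)) ->
  staircase (nilop_of_semigroup S' m) p ->
  refinement (nilop_of_semigroup S m) (nilop_of_semigroup S' m) p ->
  numerical_semigroup S -> numerical_semigroup S' -> S m -> S' m ->
  forall (e : nat) (g : e.-tuple nat) (e' : nat) (g' : e'.-tuple nat),
  minimal_generators S [set` g] -> uniq g ->
  minimal_generators S' [set` g'] -> uniq g' -> (m \in g -> m \in g') ->
  forall sigma sigma', semigroup_minimal_presentation g sigma ->
  semigroup_minimal_presentation g' sigma' ->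
  [/\ finite_set sigma, finite_set sigma' & ncard sigma <= ncard sigma'].
Proof.
rewrite !(nilop_of_semigroup_point R) => hp st ref hS hS' Sm S'm.
have [[hS0 _] [hS'0 _]] := (hS, hS').
have wP := aperyP hm hS; have w'P := aperyP hm hS'.
have kx := apery_kunz_point R hS0 wP; have kx' := apery_kunz_point R hS'0 w'P.
have [hp' sub] := refinement_nonnil kx hp kx' ref.
have [t [tn tr nt]] := staircase_section kx' hp' st.
have [s [us sE _]] := finite_set_uniq_seq (finite_minimal_nil hm kx' hp').
move=> e g e' g' ming ug ming' ug' gg' sigma sigma' minsig minsig'.
have [gen [mu [gmu sz]]] := exists_generator_embedding hm hS0 Sm wP hp ming ug kx' sub tn tr
  us (esym sE).
have [gen' [mu' [gmu' sz']]] := exists_generator_embedding hm hS'0 S'm w'P hp' ming' ug' kx'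
  (fun z nz => nz) tn tr us (esym sE).
have filterE e1 (gen1 : 'I_k -> 'I_e1) mu1 :
    [set` [seq b <- s | embed gen1 b != mu1]] =
    [set b | minimal_nil p (fun q => ((apery S' q)%:R : R)%R) b /\ embed gen1 b <> mu1].
  rewrite sE; apply/seteqP; split=> b /=; rewrite mem_filter.
    by case/andP=> /eqP.
  by case=> bs /eqP ->.
have [fsig le] := semigroup_minimal_presentation_leq hm hS0 wP hp kx' hp' sub tn tr nt gmu
  (filterE _ gen mu) minsig.
have [fsig' _] := semigroup_minimal_presentation_leq hm hS'0 w'P hp' kx' hp'
  (fun z nz => nz) tn tr nt gmu' (filterE _ gen' mu') minsig'.
split=> //; apply: leq_trans le _.
apply: leq_trans (semigroup_minimal_presentation_geq hm hS'0 w'P (fun z nz => nz) tn tr nt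
  gmu' (fun z nz => nz) (filter_uniq _ us) _ fsig' minsig'); last first.
  move=> b; have := filterE _ gen' mu' => fE bs.
  by move: (bs : [set` [seq b <- s | embed gen' b != mu']] b); rewrite fE.
(* The relations are as many as the minimal nil vectors, less one if [m] is not a generator. By
   [gg'], that loss occurs for [S] whenever it occurs for [S']. *)
rewrite -(leq_add2r (m \notin g)) sz -sz' leq_add2l.
by case: (m \in g) gg' => [/(_ isT) ->|_] //; case: (m \in g').
Qed.

Theorem theorem6p2 (R : realType) (m : nat) (hm : 1 < m)
    (N : nilop m) (hN : kunz_nilsemigroup R N)
    (k : nat) (p : k.-tuple (option 'Z_m)) (hp : enumerates p (atoms N)) :
  (exists N' : nilop m,
    [/\ kunz_nilsemigroup R N', staircase N' p & refinement N N' p]) /\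
  (forall N' : nilop m,
    kunz_nilsemigroup R N' -> staircase N' p -> refinement N N' p ->
    (forall rho : set (expvec k * expvec k), minimal_presentation N p rho ->
      [/\ finite_set rho, finite_set (outer_betti N p),
          finite_set (outer_betti N' p)
        & ncard rho + ncard (outer_betti N p) <= ncard (outer_betti N' p)]) /\
    (forall S S' : set nat,
      numerical_semigroup S -> numerical_semigroup S' -> S m -> S' m ->
      nilop_of_semigroup S m = N -> nilop_of_semigroup S' m = N' ->
      forall (e : nat) (g : e.-tuple nat) (e' : nat) (g' : e'.-tuple nat),
      minimal_generators S [set` g] -> uniq g ->
      minimal_generators S' [set` g'] -> uniq g' ->
      (m \in g -> m \in g') ->
      forall (sigma : set (expvec e * expvec e))
             (sigma' : set (expvec e' * expvec e')),
      semigroup_minimal_presentation g sigma ->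
      semigroup_minimal_presentation g' sigma' ->
      [/\ finite_set sigma, finite_set sigma' & ncard sigma <= ncard sigma'])).
Proof.
have [x kx NE] := kunz_nilsemigroup_point hN.
have hpx : enumerates p (atoms (nilop_of_point x)) by rewrite -NE.
split=> [|N' hN' st ref]; first by rewrite NE; exact: exists_staircase_refinement.
(* In the semigroup half, the Apery sets themselves are the points of the cone, in place of points
   drawn from the faces. *)
split=> [rho|S S' hS hS' Sm S'm SN SN']; last first.
  rewrite -SN in hp ref; rewrite -SN' in st ref.
  exact: (semigroup_minimal_presentation_mono R hm hp st ref).
have [x' kx' NE'] := kunz_nilsemigroup_point hN'; move: st ref; rewrite NE NE' => st ref.
have [hp' sub] := refinement_nonnil kx hpx kx' ref.
have [t [tn tr nt]] := staircase_section kx' hp' st.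
exact: (minimal_presentation_bound hm kx hpx kx' hp' sub tn tr nt).
Qed.
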